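(* Let $S$ be a discrete valuation ring having residue field $k$ and uniformising parameter $t$, let $G$ be a finite group, let $n$ be a positive integer, and set $R_n=S/t^n$. Then there is a homeomorphism $$\operatorname{Spc}(\mathsf{strel}\,R_nG)\;\cong\;\coprod_{i=1}^n\operatorname{Spc}(\mathsf{strel}\,kG),$$ where $\mathsf{strel}\,kG=\mathsf{stmod}\,kG$ is the usual stable module category. In other words, the prime ideal spectrum of $\mathsf{strel}\,R_nG$ is a disjoint union of $n$ copies of the prime ideal spectrum of $\mathsf{stmod}\,kG$.
   Context: For a commutative ring $R$ (here $R=R_n=S/t^n$ or $R=k=S/tS$) and a finite group $G$, $\mathsf{mod}\,RG$ is the category of finitely generated $RG$-modules. A short exact sequence in $\mathsf{mod}\,RG$ is called $R$-split if it splits as a sequence of $R$-modules. With the $R$-split sequences as admissible exact sequences, $\mathsf{mod}\,RG$ becomes a Frobenius exact category $\mathsf{rel}\,RG$; its projective=injective objects are the weakly projective modules, i.e. the direct summands of modules $RG\otimes_R N$ with $N\in\mathsf{mod}\,R$. Its stable category $\mathsf{strel}\,RG$ has the same objects, and morphisms are $RG$-module homomorphisms modulo those factoring through a weakly projective module; it is triangulated (triangles come from $R$-split short exact sequences). Tensoring over $R$ with diagonal $G$-action makes $\mathsf{strel}\,RG$ a tensor triangulated category with unit the trivial module $R$. For $R=k$ a field, $\mathsf{strel}\,kG=\mathsf{stmod}\,kG$. For an essentially small tensor triangulated category $\mathcal K$, a thick subcategory $\mathcal I$ is a (thick) tensor ideal if $\mathcal K\otimes\mathcal I\subseteq\mathcal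 I$. A proper thick tensor ideal $\mathcal P$ is prime if $x\otimes y\in\mathcal P$ implies $x\in\mathcal P$ or $y\in\mathcal P$. $\operatorname{Spc}\mathcal K$ is the set of prime tensor ideals, with the topology having as basis of closed sets the subsets $\operatorname{supp}(x)=\{\mathcal P\in\operatorname{Spc}\mathcal K\mid x\notin\mathcal P\}$, $x\in\mathcal K$. *)

(* Defs.v *)
From HB Require Import structures.
From mathcomp Require Import fingroup.
From mathcomp Require Import all_boot all_order all_algebra.
From mathcomp Require Import boolp.

Set Implicit Arguments.
Unset Strict Implicit.
Unset Printing Implicit Defensive.

Import GRing.Theory.
Local Open Scope ring_scope.
Local Open Scope quotient_scope.

(* Topological spaces.  The prime ideal spectrum below is a type of classes of
   modules: it lives in a universe above that of [lmodType], whereas the points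
   of a [topologicalType] must live below it, so the library's structure does
   not apply.  Subsets are plain predicates for the same reason. *)

Record space := Space {
  pt :> Type;
  is_open : (pt -> Prop) -> Prop;
  openT : is_open (fun=> True);
  openI : forall U V, is_open U -> is_open V -> is_open (fun x => U x /\ V x);
  open_bigU : forall F : (pt -> Prop) -> Prop,
    (forall U, F U -> is_open U) -> is_open (fun x => exists2 U, F U & U x) }.

Definition is_closed (X : space) (C : X -> Prop) := is_open (fun x => ~ C x).

Definition continuous_map (X Y : space) (f : X -> Y) :=
  forall V : Y -> Prop, is_open V -> is_open (fun x => V (f x)).

Definition homeomorphism (X Y : space) (f : X -> Y) :=
  continuous_map f /\
  exists g : Y -> X, [/\ cancel f g, cancel g f & continuous_map g].

Definition homeomorphic (X Y : space) :=
  exists f : X -> Y, homeomorphism f.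

Section Coproduct.
Variables (I : Type) (X : I -> space).

Definition coprod_open (U : {i : I & X i} -> Prop) :=
  forall i, is_open (fun x : X i => U (existT _ i x)).

Lemma coprod_openT : coprod_open (fun=> True).
Proof. by move=> i; exact: openT. Qed.

Lemma coprod_openI U V :
  coprod_open U -> coprod_open V -> coprod_open (fun x => U x /\ V x).
Proof. by move=> oU oV i; exact: (openI (oU i) (oV i)). Qed.

Lemma coprod_open_bigU (F : ({i : I & X i} -> Prop) -> Prop) :
  (forall U, F U -> coprod_open U) ->
  coprod_open (fun x => exists2 U, F U & U x).
Proof.
move=> oF i.
pose Fi (V : X i -> Prop) :=
  exists2 U, F U & V = (fun x => U (existT _ i x)).
have oFi V : Fi V -> is_open V by case=> U FU ->; exact: oF.
have := open_bigU oFi; congr (is_open _).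
apply/funext => x; apply/propext; split.
  by case=> _ [U FU ->] Ux; exists U.
by case=> U FU Ux; exists (fun y => U (existT _ i y)) => //; exists U.
Qed.

Definition coprod : space :=
  Space coprod_openT coprod_openI coprod_open_bigU.

End Coproduct.

(* The data of a tensor triangulated category on which its spectrum depends.
   Morphisms are given up to the equivalence [tt_heq], [tt_dist f g h] says that
   X -f-> Y -g-> Z -h-> shift X is a distinguished triangle.  The only axiom
   kept is the one that makes supports stable under finite unions. *)

Record ttcat := TTCat {
  tt_obj :> Type;
  tt_hom : tt_obj -> tt_obj -> Type;
  tt_heq : forall X Y, tt_hom X Y -> tt_hom X Y -> Prop;
  tt_id : forall X, tt_hom X X;
  tt_comp : forall X Y Z, tt_hom Y Z -> tt_hom X Y -> tt_hom X Z;
  tt_zero : tt_obj;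
  tt_dsum : tt_obj -> tt_obj -> tt_obj;
  tt_shift : tt_obj -> tt_obj;
  tt_dist : forall X Y Z,
    tt_hom X Y -> tt_hom Y Z -> tt_hom Z (tt_shift X) -> Prop;
  tt_tens : tt_obj -> tt_obj -> tt_obj;
  tt_dist_dsum : forall X Y, exists f g h, @tt_dist X (tt_dsum X Y) Y f g h }.

Section Spectrum.
Variable K : ttcat.
Implicit Types (X Y Z : K) (P : K -> Prop).

Definition tt_iso X Y := exists (f : tt_hom X Y) (g : tt_hom Y X),
  tt_heq (tt_comp g f) (tt_id X) /\ tt_heq (tt_comp f g) (tt_id Y).

(* Full subcategories are given by their objects. *)
Record thick P : Prop := Thick {
  thick_zero : P (tt_zero K);
  thick_iso : forall X Y, tt_iso X Y -> P X -> P Y;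
  thick_shift : forall X, P (tt_shift X) <-> P X;
  thick_tri : forall X Y Z f g h, @tt_dist K X Y Z f g h ->
    [/\ P X -> P Y -> P Z, P X -> P Z -> P Y & P Y -> P Z -> P X];
  thick_summand : forall X Y, P (tt_dsum X Y) -> P X /\ P Y }.

Definition tensor_ideal P := thick P /\ forall X Y, P Y -> P (tt_tens X Y).

Definition prime_ideal P :=
  [/\ tensor_ideal P,
      exists X, ~ P X &
      forall X Y, P (tt_tens X Y) -> P X \/ P Y].

Definition spc_pt := {P : K -> Prop | prime_ideal P}.

Definition supp X (p : spc_pt) : Prop := ~ sval p X.

(* The closed sets are the intersections of supports. *)
Definition spc_open (U : spc_pt -> Prop) :=
  exists A : K -> Prop, forall p, ~ U p <-> (forall X, A X -> supp X p).

Lemma spc_thick (p : spc_pt) : thick (sval p).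
Proof. by case: (svalP p) => -[]. Qed.

Lemma supp_zero p : ~ supp (tt_zero K) p.
Proof. by apply; exact: thick_zero (spc_thick p). Qed.

Lemma supp_dsum X Y p : supp (tt_dsum X Y) p <-> supp X p \/ supp Y p.
Proof.
have tP := spc_thick p; rewrite /supp; split.
  move=> nXY; case: (pselect (sval p X)) => [PX|]; last by left.
  right=> PY; apply: nXY; have [f [g [h d]]] := tt_dist_dsum X Y.
  by have [_ H _] := thick_tri tP d; exact: H.
by case=> nP /(thick_summand tP) [].
Qed.

Lemma spc_openT : spc_open (fun=> True).
Proof.
exists (fun X => X = tt_zero K) => p; split=> // H.
by case: (@supp_zero p); exact: H.
Qed.

Lemma spc_openI U V :
  spc_open U -> spc_open V -> spc_open (fun p => U p /\ V p).
Proof.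
move=> [A hA] [B hB].
exists (fun Z => exists X Y, [/\ A X, B Y & Z = tt_dsum X Y]) => p; split.
  move=> nUV _ [X [Y [AX BY ->]]]; apply/supp_dsum.
  case: (pselect (U p)) => [Up|nU]; last by left; exact: (hA p).1.
  by right; apply: (hB p).1 => // Vp; exact: nUV.
move=> H [Up Vp]; have nA : ~ forall X, A X -> supp X p by move/(hA p).2; exact.
apply: nA => X AX; apply: contrapT => nX.
have : ~ V p; last exact.
apply/(hB p) => Y BY.
have /supp_dsum [] // : supp (tt_dsum X Y) p by apply: H; exists X, Y.
Qed.

Lemma spc_open_bigU (F : (spc_pt -> Prop) -> Prop) :
  (forall U, F U -> spc_open U) -> spc_open (fun p => exists2 U, F U & U p).
Proof.
move=> oF.
exists (fun X => exists U A, [/\ F U, A X &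
  forall p, ~ U p <-> (forall X, A X -> supp X p)]) => p; split.
  move=> nU X [U [A [FU AX hA]]]; apply: (hA p).1 => // Up.
  by apply: nU; exists U.
move=> H [U FU]; have [A hA] := oF U FU; apply: (hA p).2 => X AX.
by apply: H; exists U, A.
Qed.

Definition Spc : space := Space spc_openT spc_openI spc_open_bigU.

End Spectrum.

Section PrincipalQuotient.
Variables (S : comPzRingType) (a : S).

Definition principal : {pred S} := fun x => `[< exists y, x = a * y >].

Lemma principalP x : reflect (exists y, x = a * y) (x \in principal).
Proof. exact: asboolP. Qed.

Lemma principal_zmod_closed : zmod_closed principal.
Proof.
split; first by apply/principalP; exists 0; rewrite mulr0.
move=> x y /principalP [x' ->] /principalP [y' ->].
by apply/principalP; exists (x' - y'); rewrite mulrBr.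
Qed.

HB.instance Definition _ :=
  GRing.isZmodClosed.Build S principal principal_zmod_closed.

(* The ring S/aS.  The library's {ideal_quot _} requires a proper ideal. *)
Definition principal_quot := Quotient.quot principal.
HB.instance Definition _ := GRing.Zmodule.on principal_quot.
HB.instance Definition _ := EqQuotient.on principal_quot.

Local Notation Q := principal_quot.

Definition pquot_one : Q := \pi_Q 1.
Definition pquot_mul := lift_op2 Q *%R.

Lemma pquotP x y : reflect (exists z, x - y = a * z) (\pi_Q x == \pi_Q y).
Proof. by rewrite -Quotient.idealrBE; exact: principalP. Qed.

Lemma pquot_piM x y : pquot_mul (\pi_Q x) (\pi_Q y) = \pi_Q (x * y).
Proof.
have [u hu] : exists z, repr (\pi_Q x) - x = a * z.
  by apply/pquotP; rewrite reprK.
have [v hv] : exists z, repr (\pi_Q y) - y = a * z.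
  by apply/pquotP; rewrite reprK.
unlock pquot_mul; apply/eqP/pquotP; exists (u * repr (\pi_Q y) + x * v).
by rewrite mulrDr mulrA -hu mulrCA -hv mulrBl mulrBr addrA subrK.
Qed.

Lemma pquot_piD x y : \pi_Q x + \pi_Q y = \pi_Q (x + y).
Proof. by symmetry; exact: (Quotient.pi_add principal). Qed.

Lemma pquot_mulA : associative pquot_mul.
Proof.
by move=> x y z; rewrite -[x]reprK -[y]reprK -[z]reprK !pquot_piM mulrA.
Qed.

Lemma pquot_mulC : commutative pquot_mul.
Proof. by move=> x y; rewrite -[x]reprK -[y]reprK !pquot_piM mulrC. Qed.

Lemma pquot_mul1 : left_id pquot_one pquot_mul.
Proof. by move=> x; rewrite -[x]reprK !pquot_piM mul1r. Qed.

Lemma pquot_mulDl : left_distributive pquot_mul +%R.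
Proof.
move=> x y z; rewrite -[x]reprK -[y]reprK -[z]reprK.
by rewrite pquot_piD !pquot_piM pquot_piD mulrDl.
Qed.

HB.instance Definition _ := GRing.Zmodule_isComPzRing.Build principal_quot
  pquot_mulA pquot_mulC pquot_mul1 pquot_mulDl.

End PrincipalQuotient.

(* Discrete valuation rings: local principal ideal domains that are not fields,
   with uniformising parameters the generators of the maximal ideal. *)
Section DiscreteValuationRing.
Variable S : idomainType.
Implicit Types I J : S -> Prop.

Definition is_ideal I := I 0 /\ forall a x y, I x -> I y -> I (a * x + y).

Definition maximal_ideal I :=
  [/\ is_ideal I, ~ I 1 &
      forall J, is_ideal J -> ~ J 1 -> (forall x, I x -> J x) ->
        forall x, J x -> I x].

Definition dvr :=
  [/\ forall I, is_ideal I -> exists t, forall x, I x <-> x \in principal t,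
      exists2 I, maximal_ideal I &
        forall J, maximal_ideal J -> forall x, J x <-> I x &
      exists2 x : S, x != 0 & x \isn't a GRing.unit].

Definition uniformiser (t : S) := maximal_ideal (fun x => x \in principal t).

End DiscreteValuationRing.

Section LinearQuotient.
Variables (R : comPzRingType) (M L : lmodType R) (i : {linear L -> M}).

Definition im_pred : {pred M} := fun x => `[< exists y, x = i y >].

Lemma im_predP x : reflect (exists y, x = i y) (x \in im_pred).
Proof. exact: asboolP. Qed.

Lemma im_pred_zmod_closed : zmod_closed im_pred.
Proof.
split; first by apply/im_predP; exists 0; rewrite linear0.
move=> x y /im_predP [x' ->] /im_predP [y' ->].
by apply/im_predP; exists (x' - y'); rewrite linearB.
Qed.

HB.instance Definition _ :=
  GRing.isZmodClosed.Build M im_pred im_pred_zmod_closed.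

Definition coker := Quotient.quot im_pred.
HB.instance Definition _ := GRing.Zmodule.on coker.
HB.instance Definition _ := EqQuotient.on coker.

Definition coker_scale (a : R) := lift_op1 coker ( *:%R a).

Lemma coker_piP x y : \pi_coker x = \pi_coker y <-> exists z, x - y = i z.
Proof.
split=> [/eqP|]; first by rewrite -Quotient.idealrBE => /im_predP.
by move=> h; apply/eqP; rewrite -Quotient.idealrBE; apply/im_predP.
Qed.

Lemma coker_piD x y : \pi_coker x + \pi_coker y = \pi_coker (x + y).
Proof. by symmetry; exact: (Quotient.pi_add im_pred). Qed.

Lemma coker_piZ a x : coker_scale a (\pi_coker x) = \pi_coker (a *: x).
Proof.
unlock coker_scale; apply/coker_piP.
have /coker_piP [z hz] : \pi_coker (repr (\pi_coker x)) = \pi_coker x.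
  by rewrite reprK.
by exists (a *: z); rewrite (linearZ_LR i) -hz scalerBr.
Qed.

Lemma coker_scaleA a b v :
  coker_scale a (coker_scale b v) = coker_scale (a * b) v.
Proof. by rewrite -[v]reprK !coker_piZ scalerA. Qed.

Lemma coker_scale1 : left_id 1 coker_scale.
Proof. by move=> v; rewrite -[v]reprK coker_piZ scale1r. Qed.

Lemma coker_scaleDr : right_distributive coker_scale +%R.
Proof.
move=> a x y; rewrite -[x]reprK -[y]reprK.
by rewrite coker_piD !coker_piZ coker_piD scalerDr.
Qed.

Lemma coker_scaleDl v : {morph coker_scale^~ v : a b / a + b}.
Proof.
by move=> a b; rewrite /= -[v]reprK !coker_piZ coker_piD scalerDl.
Qed.

HB.instance Definition _ := GRing.Zmodule_isLmodule.Build R coker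
  coker_scaleA coker_scale1 coker_scaleDr coker_scaleDl.

Definition coker_pi (x : M) : coker := \pi_coker x.

Lemma coker_pi_linear : linear coker_pi.
Proof.
by move=> a x y; rewrite /coker_pi -coker_piD -coker_piZ.
Qed.

HB.instance Definition _ :=
  GRing.isLinear.Build R M coker _ coker_pi coker_pi_linear.

End LinearQuotient.

Section TensorProduct.
Variables (R : comPzRingType) (M N : lmodType R).

Definition bilinear_map (P : lmodType R) (b : M -> N -> P) :=
  (forall a x x' y, b (a *: x + x') y = a *: b x y + b x' y) /\
  (forall a x y y', b x (a *: y + y') = a *: b x y + b x y').

(* A list stands for the formal sum of its pairs, and two of them are
   identified when no bilinear map separates them: this makes the quotient the
   universal recipient of a bilinear map, see [tprod_universal]. *)
Definition fsum := seq (M * N).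

Definition fsum_ev (P : lmodType R) (b : M -> N -> P) (u : fsum) : P :=
  \sum_(z <- u) b z.1 z.2.

Definition fsum_eqv (u v : fsum) : bool :=
  `[< forall (P : lmodType R) (b : M -> N -> P), bilinear_map b ->
        fsum_ev b u = fsum_ev b v >].

Lemma fsum_eqv_class : equiv_class_of fsum_eqv.
Proof.
split=> [u|u v|v u w]; first exact/asboolP.
  by apply/asboolP/asboolP => h P b hb; rewrite h.
by move=> /asboolP h /asboolP h'; apply/asboolP => P b hb; rewrite h ?h'.
Qed.

Canonical fsum_eqv_equiv := EquivRelPack fsum_eqv_class.
Canonical fsum_eqv_encModRel := defaultEncModRel fsum_eqv.

Definition tprod := {eq_quot fsum_eqv}.
HB.instance Definition _ := EqQuotient.on tprod.
HB.instance Definition _ := Choice.on tprod.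

(* The map out of the tensor product induced by [b], when bilinear. *)
Definition tprod_ev (P : lmodType R) (b : M -> N -> P) (x : tprod) : P :=
  fsum_ev b (repr x).

Lemma tprod_ev_pi (P : lmodType R) (b : M -> N -> P) u :
  bilinear_map b -> tprod_ev b (\pi_tprod u) = fsum_ev b u.
Proof.
move=> hb; have : \pi_tprod (repr (\pi_tprod u)) = \pi_tprod u.
  by rewrite reprK.
by move/eqP; rewrite eqquotE => /asboolP; apply.
Qed.

Lemma tprod_evP x y :
  (forall (P : lmodType R) (b : M -> N -> P), bilinear_map b ->
     tprod_ev b x = tprod_ev b y) -> x = y.
Proof.
move=> h; rewrite -[x]reprK -[y]reprK; apply/eqP.
by rewrite eqquotE; apply/asboolP => P b hb; exact: h.
Qed.

Definition tprod_zero : tprod := \pi_tprod [::].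
Definition tprod_add (x y : tprod) : tprod := \pi_tprod (repr x ++ repr y).
Definition tprod_scale (a : R) (x : tprod) : tprod :=
  \pi_tprod [seq (a *: z.1, z.2) | z <- repr x].
Definition tprod_opp : tprod -> tprod := tprod_scale (-1).

Section Ev.
Variables (P : lmodType R) (b : M -> N -> P).
Hypothesis hb : bilinear_map b.

Lemma bilinear_map0l y : b 0 y = 0.
Proof.
have := hb.1 1 0 0 y; rewrite !scale1r addr0 => /eqP.
by rewrite -subr_eq subrr eq_sym => /eqP.
Qed.

Lemma bilinear_mapZl a x y : b (a *: x) y = a *: b x y.
Proof. by rewrite -[a *: x]addr0 hb.1 bilinear_map0l addr0. Qed.

Lemma tprod_ev0 : tprod_ev b tprod_zero = 0.
Proof. by rewrite tprod_ev_pi // /fsum_ev big_nil. Qed.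

Lemma tprod_evD x y :
  tprod_ev b (tprod_add x y) = tprod_ev b x + tprod_ev b y.
Proof. by rewrite tprod_ev_pi // /fsum_ev big_cat. Qed.

Lemma tprod_evZ a x : tprod_ev b (tprod_scale a x) = a *: tprod_ev b x.
Proof.
rewrite tprod_ev_pi // /tprod_ev /fsum_ev big_map scaler_sumr.
by apply: eq_bigr => z _; rewrite bilinear_mapZl.
Qed.

End Ev.

Lemma tprod_addA : associative tprod_add.
Proof.
by move=> x y z; apply: tprod_evP => P b hb; rewrite !tprod_evD // addrA.
Qed.

Lemma tprod_addC : commutative tprod_add.
Proof.
by move=> x y; apply: tprod_evP => P b hb; rewrite !tprod_evD // addrC.
Qed.

Lemma tprod_add0 : left_id tprod_zero tprod_add.
Proof.
by move=> x; apply: tprod_evP => P b hb; rewrite tprod_evD // tprod_ev0 // add0r.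
Qed.

Lemma tprod_addN : left_inverse tprod_zero tprod_opp tprod_add.
Proof.
move=> x; apply: tprod_evP => P b hb.
by rewrite tprod_evD // tprod_evZ // tprod_ev0 // scaleN1r addNr.
Qed.

HB.instance Definition _ := GRing.isZmodule.Build tprod
  tprod_addA tprod_addC tprod_add0 tprod_addN.

Lemma tprod_scaleA a b x :
  tprod_scale a (tprod_scale b x) = tprod_scale (a * b) x.
Proof. by apply: tprod_evP => P c hc; rewrite !tprod_evZ // scalerA. Qed.

Lemma tprod_scale1 : left_id 1 tprod_scale.
Proof. by move=> x; apply: tprod_evP => P c hc; rewrite tprod_evZ // scale1r. Qed.

Lemma tprod_scaleDr : right_distributive tprod_scale +%R.
Proof.
move=> a x y; apply: tprod_evP => P c hc.
by rewrite tprod_evZ // !tprod_evD // !tprod_evZ // scalerDr.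
Qed.

Lemma tprod_scaleDl x : {morph tprod_scale^~ x : a b / a + b}.
Proof.
move=> a b; apply: tprod_evP => P c hc.
by rewrite tprod_evZ // tprod_evD // !tprod_evZ // scalerDl.
Qed.

HB.instance Definition _ := GRing.Zmodule_isLmodule.Build R tprod
  tprod_scaleA tprod_scale1 tprod_scaleDr tprod_scaleDl.

Definition pure (x : M) (y : N) : tprod := \pi_tprod [:: (x, y)].

Lemma tprod_ev_pure (P : lmodType R) (b : M -> N -> P) x y :
  bilinear_map b -> tprod_ev b (pure x y) = b x y.
Proof. by move=> hb; rewrite tprod_ev_pi // /fsum_ev big_seq1. Qed.

Lemma tprod_ev_linear (P : lmodType R) (b : M -> N -> P) :
  bilinear_map b -> linear (tprod_ev b).
Proof. by move=> hb a x y; rewrite tprod_evD // tprod_evZ. Qed.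

Lemma pure_bilinear : bilinear_map pure.
Proof.
split=> [a x x' y|a x y y']; apply: tprod_evP => P b hb;
  by rewrite tprod_evD // tprod_evZ // !tprod_ev_pure // (hb.1, hb.2).
Qed.

Lemma tprod_sum_pure x : x = \sum_(z <- repr x) pure z.1 z.2.
Proof.
apply: tprod_evP => P b hb; rewrite {1}/tprod_ev /fsum_ev.
elim: (repr x) => [|z u IH]; first by rewrite !big_nil tprod_ev0.
by rewrite !big_cons tprod_evD // tprod_ev_pure // IH.
Qed.

Lemma tprod_universal (P : lmodType R) (b : M -> N -> P) : bilinear_map b ->
  exists2 f : {linear tprod -> P}, (forall x y, f (pure x y) = b x y) &
    forall f' : {linear tprod -> P},
      (forall x y, f' (pure x y) = b x y) -> f' =1 f.
Proof.
move=> hb.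
pose f := HB.pack_for {linear tprod -> P} (tprod_ev b)
  (GRing.isLinear.Build R tprod P _ _ (tprod_ev_linear hb)).
exists f => [x y|f' hf' x]; first exact: tprod_ev_pure.
rewrite [in LHS](tprod_sum_pure x) linear_sum.
by apply: eq_bigr => z _; rewrite hf'.
Qed.

End TensorProduct.

Definition spans (R : pzRingType) (M : lmodType R) (I : finType) (s : I -> M) :=
  forall x, exists c : I -> R, x = \sum_i c i *: s i.

Definition fin_gen (R : pzRingType) (M : lmodType R) :=
  exists (m : nat) (s : 'I_m -> M), spans s.

(* Finitely generated RG-modules, an RG-module being an R-module with an
   R-linear action of G: the combination of the generators [s i] in [fgmod_fg]
   has coefficients sum_g c i g g in RG. *)
Record fgmod (R : comPzRingType) (G : finGroupType) := FGMod {
  carrier :> lmodType R;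
  act : G -> {linear carrier -> carrier};
  act1 : act 1%g =1 id;
  actM : forall g h x, act (g * h)%g x = act g (act h x);
  fgmod_fg : exists (m : nat) (s : 'I_m -> carrier),
    forall x, exists c : 'I_m -> G -> R,
      x = \sum_i \sum_g c i g *: act g (s i) }.

Arguments act {R G f}.

Section RGModules.
Variables (R : comPzRingType) (G : finGroupType).
Implicit Types (L M N : fgmod R G).

Lemma spans_fg (M : lmodType R) (act : G -> {linear M -> M}) (I : finType)
  (s : I -> M) : act 1%g =1 id -> spans s ->
  exists (m : nat) (s : 'I_m -> M), forall x, exists c : 'I_m -> G -> R,
    x = \sum_i \sum_g c i g *: act g (s i).
Proof.
move=> act1 hs; exists #|I|, (s \o enum_val) => x; have [c ->] := hs x.
exists (fun i g => if g == 1%g then c (enum_val i) else 0).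
rewrite (reindex_onto enum_val enum_rank) => [|i _]; last exact: enum_rankK.
rewrite (eq_bigl predT) => [|i]; last by rewrite enum_valK eqxx.
apply: eq_bigr => i _; rewrite (bigD1 1%g) //= eqxx act1 big1 ?addr0 // => g.
by move=> /negPf ->; rewrite scale0r.
Qed.

Lemma fgmod_spans M : exists (I : finType) (s : I -> M), spans s.
Proof.
have [m [s hs]] := fgmod_fg M.
exists ('I_m * G)%type, (fun z => act z.2 (s z.1)) => x.
have [c ->] := hs x; exists (fun z => c z.1 z.2).
by rewrite pair_bigA.
Qed.

Lemma fgmod_fin_gen M : fin_gen M.
Proof.
have [I [s hs]] := fgmod_spans M; exists #|I|, (s \o enum_val) => x.
have [c ->] := hs x; exists (c \o enum_val).
rewrite (reindex_onto enum_val enum_rank) => [|i _]; last exact: enum_rankK.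
by apply: eq_bigl => i; rewrite enum_valK eqxx.
Qed.

Lemma spans_pred (M : lmodType R) (I : finType) (s : I -> M) :
  let P x := exists c : I -> R, x = \sum_i c i *: s i in
  [/\ P 0, forall x y, P x -> P y -> P (x + y),
      forall a x, P x -> P (a *: x) & forall i, P (s i)].
Proof.
split=> [|_ _ [c ->] [d ->]|a _ [c ->]|i].
- by exists (fun=> 0); rewrite big1 // => i _; rewrite scale0r.
- exists (fun i => c i + d i); rewrite -big_split.
  by apply: eq_bigr => i _; rewrite scalerDl.
- exists (fun i => a * c i); rewrite scaler_sumr.
  by apply: eq_bigr => i _; rewrite scalerA.
- exists (fun j => if j == i then 1 else 0).
  rewrite (bigD1 i) //= eqxx scale1r big1 ?addr0 // => j /negPf ->.
  by rewrite scale0r.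
Qed.

Lemma spans_sum (M : lmodType R) (I : finType) (s : I -> M) (J : Type)
    (r : seq J) (F : J -> M) :
  (forall j, exists c : I -> R, F j = \sum_i c i *: s i) ->
  exists c : I -> R, \sum_(j <- r) F j = \sum_i c i *: s i.
Proof.
by have [P0 PD _ _] := spans_pred s; move=> hF; apply: (big_ind _ P0 PD).
Qed.

Record ghom M N := GHom {
  ghom_fun :> {linear M -> N};
  ghom_act : forall g x, ghom_fun (act g x) = act g (ghom_fun x) }.

Section Linear.
Variables (U V : lmodType R) (f : U -> V) (lf : linear f).
Definition mklin : {linear U -> V} :=
  HB.pack_for {linear U -> V} f (GRing.isLinear.Build R U V _ f lf).
Lemma mklinE x : mklin x = f x. Proof. by []. Qed.
End Linear.

Definition ghom_id M : ghom M M :=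
  @GHom M M [the {linear M -> M} of idfun] (fun g x => erefl).

Lemma ghom_comp_act L M N (f : ghom M N) (h : ghom L M) g x :
  (f \o h) (act g x) = act g ((f \o h) x).
Proof. by rewrite /= !ghom_act. Qed.

Definition ghom_comp L M N (f : ghom M N) (h : ghom L M) : ghom L N :=
  @GHom L N [the {linear L -> N} of f \o h] (ghom_comp_act f h).

Definition fgmod_iso M N := exists (f : ghom M N) (h : ghom N M),
  cancel f h /\ cancel h f.

Lemma id_linear (U : lmodType R) : linear (@id U).
Proof. by []. Qed.

Section Trivial.
Variables (N : lmodType R) (hN : fin_gen N).

Lemma triv_fg : exists (m : nat) (s : 'I_m -> N),
  forall x, exists c : 'I_m -> G -> R,
    x = \sum_i \sum_g c i g *: mklin (@id_linear N) (s i).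
Proof.
by have [m [s hs]] := hN; exact: (@spans_fg N (fun=> mklin (@id_linear N)) _ s).
Qed.

(* N with the trivial action of G. *)
Definition triv : fgmod R G :=
  @FGMod R G N (fun=> mklin (@id_linear N)) (fun=> erefl)
    (fun _ _ _ => erefl) triv_fg.

End Trivial.

Lemma fin_gen0 : fin_gen 'rV[R]_0.
Proof.
exists 0%N, (fun=> 0) => x; exists (fun=> 0).
by apply/rowP => -[].
Qed.

Definition zero_mod : fgmod R G := triv fin_gen0.

Section DirectSum.
Variables M N : fgmod R G.

Lemma dsum_act_linear g :
  linear (fun z : (M * N)%type => (act g z.1, act g z.2) : (M * N)%type).
Proof. by move=> a [x y] [x' y']; rewrite /= !linearP. Qed.

Definition dsum_act g := mklin (dsum_act_linear g).

Lemma dsum_act1 : dsum_act 1%g =1 id.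
Proof. by case=> x y; rewrite mklinE /= !act1. Qed.

Lemma dsum_actM g h x : dsum_act (g * h)%g x = dsum_act g (dsum_act h x).
Proof. by rewrite !mklinE /= !actM. Qed.

Lemma dsum_fg : exists (m : nat) (s : 'I_m -> (M * N)%type),
  forall x, exists c : 'I_m -> G -> R,
    x = \sum_i \sum_g c i g *: dsum_act g (s i).
Proof.
have [I [s hs]] := fgmod_spans M; have [J [r hr]] := fgmod_spans N.
pose t (k : I + J) : (M * N)%type :=
  match k with inl i => (s i, 0) | inr j => (0, r j) end.
apply: (@spans_fg _ _ _ t dsum_act1) => -[x y].
have [c ->] := hs x; have [d ->] := hr y.
exists (fun k => match k with inl i => c i | inr j => d j end).
rewrite big_sumType /=.
transitivity ((\sum_i c i *: s i, 0) + (0, \sum_j d j *: r j) : (M * N)%type).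
  by congr (_, _); rewrite /= ?addr0 ?add0r.
congr (_ + _).
  rewrite (eq_bigr (fun i => (c i *: s i, 0 : N))) => [|i _]; last first.
    by congr (_, _); rewrite /= scaler0.
  by elim/big_rec2: _ => // i y1 y2 _ <-; congr (_, _); rewrite /= addr0.
rewrite (eq_bigr (fun i => (0 : M, d i *: r i))) => [|i _]; last first.
  by congr (_, _); rewrite /= scaler0.
by elim/big_rec2: _ => // i y1 y2 _ <-; congr (_, _); rewrite /= addr0.
Qed.

Definition dsum : fgmod R G := FGMod dsum_act1 dsum_actM dsum_fg.

End DirectSum.

Section Tensor.
Variables M N : fgmod R G.

Lemma pure_act_bilinear g :
  bilinear_map (fun (x : M) (y : N) => pure (act g x) (act g y)).
Proof.
have [hl hr] := @pure_bilinear R M N.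
by split=> [a x x' y|a x y y']; rewrite linearP (hl, hr).
Qed.

Definition tens_act g : {linear tprod M N -> tprod M N} :=
  mklin (tprod_ev_linear (pure_act_bilinear g)).

Lemma tens_act_pure g x y : tens_act g (pure x y) = pure (act g x) (act g y).
Proof. by rewrite mklinE (tprod_ev_pure _ _ (pure_act_bilinear g)). Qed.

Lemma tens_act1 : tens_act 1%g =1 id.
Proof.
move=> x; rewrite (tprod_sum_pure x) linear_sum.
by apply: eq_bigr => z _; rewrite tens_act_pure !act1.
Qed.

Lemma tens_actM g h x : tens_act (g * h)%g x = tens_act g (tens_act h x).
Proof.
rewrite (tprod_sum_pure x) (linear_sum (tens_act (g * h)%g)).
rewrite (linear_sum (tens_act h)) (linear_sum (tens_act g)).
by apply: eq_bigr => z _; rewrite !tens_act_pure !actM.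
Qed.

Lemma tens_fg : exists (m : nat) (s : 'I_m -> tprod M N),
  forall x, exists c : 'I_m -> G -> R,
    x = \sum_i \sum_g c i g *: tens_act g (s i).
Proof.
have [I [s hs]] := fgmod_spans M; have [J [r hr]] := fgmod_spans N.
pose t (k : I * J) : tprod M N := pure (s k.1) (r k.2).
apply: (@spans_fg _ _ _ t tens_act1) => x.
rewrite (tprod_sum_pure x); apply: spans_sum => -[y z] /=.
have [P0 PD PZ Pt] := spans_pred t.
have [hl hrr] := @pure_bilinear R M N.
have pl : linear (fun y => pure y z : tprod M N) by move=> a u v; exact: hl.
have pr u : linear (fun z => pure u z : tprod M N) by move=> a v w; exact: hrr.
have [c ->] := hs y.
have -> : pure (\sum_i c i *: s i) z = \sum_i c i *: pure (s i) z.
  rewrite -[LHS](mklinE pl) linear_sum.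
  by apply: eq_bigr => i _; rewrite linearZ.
apply: spans_sum => i; apply: (PZ (c i)); have [d ->] := hr z.
have -> : pure (s i) (\sum_j d j *: r j) = \sum_j d j *: pure (s i) (r j).
  rewrite -[LHS](mklinE (pr (s i))) linear_sum.
  by apply: eq_bigr => j _; rewrite linearZ.
by apply: spans_sum => j; apply: PZ; exact: (Pt (i, j)).
Qed.

Definition tens : fgmod R G := FGMod tens_act1 tens_actM tens_fg.

End Tensor.

(* Here f stands for the element sum_h h (x) f h of RG (x)_R M with diagonal
   action. *)
Section FunctionModule.
Variable M : fgmod R G.

Lemma ffun_act_linear g : linear (fun f : {ffun G -> M} =>
  [ffun h => act g (f (g^-1 * h)%g)] : {ffun G -> M}).
Proof. by move=> a f f'; apply/ffunP => h; rewrite !ffunE linearP. Qed.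

Definition ffun_act g := mklin (ffun_act_linear g).

Lemma ffun_act1 : ffun_act 1%g =1 id.
Proof.
by move=> f; apply/ffunP => h; rewrite mklinE ffunE act1 invg1 mul1g.
Qed.

Lemma ffun_actM g h f : ffun_act (g * h)%g f = ffun_act g (ffun_act h f).
Proof.
apply/ffunP => k; rewrite !mklinE !ffunE actM.
by rewrite invMg mulgA.
Qed.

Lemma ffun_fg : exists (m : nat) (s : 'I_m -> {ffun G -> M}),
  forall x, exists c : 'I_m -> G -> R,
    x = \sum_i \sum_g c i g *: ffun_act g (s i).
Proof.
have [I [s hs]] := fgmod_spans M.
pose t (k : G * I) : {ffun G -> M} :=
  [ffun h => if h == k.1 then s k.2 else 0].
apply: (@spans_fg _ _ _ t ffun_act1) => f.
have /choice [c hc] : forall h, exists c : I -> R, f h = \sum_i c i *: s i.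
  by move=> h; exact: hs.
exists (fun k => c k.1 k.2); apply/ffunP => h; rewrite hc.
rewrite -(pair_bigA _ (fun g i => c g i *: t (g, i))) /= sum_ffunE.
rewrite (bigD1 h) //= [X in _ + X]big1 ?addr0 => [|g /negPf gh].
  rewrite sum_ffunE.
  by apply: eq_bigr => i _; rewrite !ffunE /= eqxx.
rewrite sum_ffunE big1 // => i _.
by rewrite !ffunE /= eq_sym gh scaler0.
Qed.

Definition ffun_mod : fgmod R G := FGMod ffun_act1 ffun_actM ffun_fg.

End FunctionModule.
Section Cokernel.
Variables (L M : fgmod R G) (i : ghom L M).

Definition coker_act_fun g (q : coker i) : coker i :=
  coker_pi i (act g (repr q)).

Lemma coker_act_pi g x : coker_act_fun g (coker_pi i x) = coker_pi i (act g x).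
Proof.
apply/coker_piP.
have /coker_piP [z hz] : coker_pi i (repr (coker_pi i x)) = coker_pi i x.
  exact: reprK.
by exists (act g z); rewrite ghom_act -hz linearB.
Qed.

Lemma coker_pi_surj (q : coker i) : exists x, q = coker_pi i x.
Proof. by exists (repr q); rewrite /coker_pi reprK. Qed.

Lemma coker_act_linear g : linear (coker_act_fun g).
Proof.
move=> a q q'; have [x ->] := coker_pi_surj q; have [y ->] := coker_pi_surj q'.
by rewrite -linearP !coker_act_pi !linearP.
Qed.

Definition coker_act g := mklin (coker_act_linear g).

Lemma coker_act1 : coker_act 1%g =1 id.
Proof.
move=> q; have [x ->] := coker_pi_surj q.
by rewrite mklinE coker_act_pi act1.
Qed.

Lemma coker_actM g h q : coker_act (g * h)%g q = coker_act g (coker_act h q).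
Proof.
have [x ->] := coker_pi_surj q.
by rewrite !mklinE !coker_act_pi actM.
Qed.

Lemma coker_fg : exists (m : nat) (s : 'I_m -> coker i),
  forall x, exists c : 'I_m -> G -> R,
    x = \sum_i \sum_g c i g *: coker_act g (s i).
Proof.
have [J [s hs]] := fgmod_spans M.
apply: (@spans_fg _ _ _ (fun j => coker_pi i (s j)) coker_act1) => q.
have [x ->] := coker_pi_surj q; have [c ->] := hs x; exists c.
by rewrite linear_sum; apply: eq_bigr => j _; rewrite linearZ.
Qed.

Definition coker_mod : fgmod R G := FGMod coker_act1 coker_actM coker_fg.

Definition coker_proj : ghom M coker_mod :=
  @GHom M coker_mod (coker_pi i) (fun g x => esym (coker_act_pi g x)).

End Cokernel.

Lemma fin_gen1 : fin_gen R^o.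
Proof.
by exists 1%N, (fun=> 1) => x; exists (fun=> x); rewrite big_ord1 /GRing.scale /= mulr1.
Qed.

(* The regular module RG: the action on [triv] being trivial, f stands for the
   element sum_h f h h of RG. *)
Definition regular : fgmod R G := ffun_mod (triv fin_gen1).

(* In the tensor product of [regular] with a trivial module, G acts on the left
   factor only: this is RG (x)_R N. *)
Definition weakly_projective (W : fgmod R G) :=
  exists (N : lmodType R) (hN : fin_gen N) (W' : fgmod R G),
    fgmod_iso (dsum W W') (tens regular (triv hN)).

(* Equality in the stable category. *)
Definition ghom_eqv M N (f f' : ghom M N) :=
  exists (W : fgmod R G) (u : ghom M W) (v : ghom W N),
    weakly_projective W /\ forall x, f x - f' x = v (u x).

Definition R_split_exact L M N (i : ghom L M) (p : ghom M N) :=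
  [/\ injective i,
      forall y, p y = 0 <-> exists x, y = i x,
      forall z, exists y, z = p y &
      exists s : {linear N -> M}, cancel s p].

(* The shift is computed on the sequence 0 -> M -> {ffun G -> M} -> shift M -> 0
   where x is sent to the constant function x, that is, to sum_h h (x) x in
   RG (x)_R M.  It is R-split exact with weakly projective middle term, by
   [shift_exact] and [ffun_mod_weakly_projective]. *)
Section Shift.
Variable M : fgmod R G.

Lemma const_linear : linear (fun x : M => [ffun=> x] : ffun_mod M).
Proof. by move=> a x y; apply/ffunP => h; rewrite !ffunE. Qed.

Lemma const_act g x :
  mklin const_linear (act g x) = act g (mklin const_linear x).
Proof. by apply/ffunP => h; rewrite !mklinE !ffunE. Qed.

Definition const_hom : ghom M (ffun_mod M) := GHom const_act.

Definition shift : fgmod R G := coker_mod const_hom.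

Definition shift_proj : ghom (ffun_mod M) shift := coker_proj const_hom.

End Shift.

(* [s] is the morphism induced by [f] on shifts. *)
Definition shift_of L M (f : ghom L M) (s : ghom (shift L) (shift M)) :=
  forall x : ffun_mod L,
    s (shift_proj L x) = shift_proj M [ffun h => f (x h)].

(* [w] is a connecting morphism of the short exact sequence (i, p). *)
Definition connecting L M N (i : ghom L M) (p : ghom M N)
    (w : ghom N (shift L)) :=
  exists u : ghom M (ffun_mod L),
    (forall x, u (i x) = const_hom L x) /\
    (forall y, w (p y) = shift_proj L (u y)).

Definition stable_iso M N (f : ghom M N) := exists f' : ghom N M,
  ghom_eqv (ghom_comp f' f) (ghom_id M) /\
  ghom_eqv (ghom_comp f f') (ghom_id N).

(* [distinguished]: the triangles isomorphic in the stable category to the one of an R-split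
   short exact sequence. *)
Definition distinguished X Y Z
    (f : ghom X Y) (g : ghom Y Z) (h : ghom Z (shift X)) :=
  exists (L M N : fgmod R G) (i : ghom L M) (p : ghom M N)
         (w : ghom N (shift L)),
    [/\ R_split_exact i p, connecting i p w &
      exists (a : ghom X L) (b : ghom Y M) (c : ghom Z N)
             (s : ghom (shift X) (shift L)),
        [/\ [/\ stable_iso a, stable_iso b, stable_iso c & shift_of a s],
            ghom_eqv (ghom_comp b f) (ghom_comp i a),
            ghom_eqv (ghom_comp c g) (ghom_comp p b) &
            ghom_eqv (ghom_comp s h) (ghom_comp w c)]].

Section Zero.
Variables M N : fgmod R G.

Lemma zero_linear : linear (fun _ : M => 0 : N).
Proof. by move=> a x y; rewrite scaler0 addr0. Qed.

Lemma zero_act g x : mklin zero_linear (act g x) = act g (mklin zero_linear x).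
Proof. by rewrite !mklinE linear0. Qed.

Definition ghom_zero : ghom M N := GHom zero_act.

Lemma inl_linear : linear (fun x : M => (x, 0) : dsum M N).
Proof. by move=> a x y; congr (_, _); rewrite /= scaler0 addr0. Qed.

Lemma inl_act g x : mklin inl_linear (act g x) = act g (mklin inl_linear x).
Proof. by rewrite !mklinE; congr (_, _); rewrite /= linear0. Qed.

Definition ghom_inl : ghom M (dsum M N) := GHom inl_act.

Lemma fst_linear : linear (fun z : dsum M N => z.1).
Proof. by []. Qed.

Definition ghom_fst : ghom (dsum M N) M :=
  @GHom (dsum M N) M (mklin fst_linear) (fun _ _ => erefl).

Lemma snd_linear : linear (fun z : dsum M N => z.2).
Proof. by []. Qed.

Definition ghom_snd : ghom (dsum M N) N :=
  @GHom (dsum M N) N (mklin snd_linear) (fun _ _ => erefl).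

End Zero.

Lemma ghom_eqv_ext M N (f f' : ghom M N) : f =1 f' -> ghom_eqv f f'.
Proof.
move=> ff'; exists (tens regular (triv fin_gen0)), (ghom_zero _ _),
  (ghom_zero _ _); split; last by move=> x; rewrite ff' subrr.
exists 'rV[R]_0, fin_gen0, zero_mod, (ghom_fst _ _), (ghom_inl _ _).
split=> // -[x y]; congr (_, _).
by apply/rowP => -[].
Qed.

Lemma stable_iso_id M : stable_iso (ghom_id M).
Proof. by exists (ghom_id M); split; exact: ghom_eqv_ext. Qed.

Lemma distinguished_dsum X Y :
  exists (f : ghom X (dsum X Y)) (g : ghom (dsum X Y) Y)
         (h : ghom Y (shift X)), distinguished f g h.
Proof.
exists (ghom_inl X Y), (ghom_snd X Y), (ghom_zero Y (shift X)).
exists X, (dsum X Y), Y, (ghom_inl X Y), (ghom_snd X Y),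
  (ghom_zero Y (shift X)); split.
- split; first by move=> x x' [].
  + move=> [x y]; split=> [/= ->|[x' [_ ->]] //].
    by exists x.
  + by move=> y; exists (0, y).
  + have lr : linear (fun y : Y => (0, y) : dsum X Y).
      by move=> a y y'; congr (_, _); rewrite /= scaler0 addr0.
    by exists (mklin lr).
- exists (ghom_comp (const_hom X) (ghom_fst X Y)); split=> // y.
  rewrite -[LHS](linear0 (shift_proj X)); apply/esym/coker_piP.
  by exists y.1; rewrite subr0.
- exists (ghom_id _), (ghom_id _), (ghom_id _), (ghom_id _).
  split; try exact: ghom_eqv_ext.
  split; try exact: stable_iso_id.
  by move=> x; congr (shift_proj X _); apply/ffunP => h; rewrite ffunE.
Qed.

Section ShiftSequence.
Variable M : fgmod R G.
Let T := tens regular (triv (fgmod_fin_gen M)).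

Definition untwist (r : regular) (x : M) : ffun_mod M :=
  [ffun h => r h *: act h x].

Lemma untwist_bilinear : @bilinear_map R regular M (ffun_mod M) untwist.
Proof.
split=> [a r r' x|a r x x']; apply/ffunP => h; rewrite !ffunE.
  by rewrite scalerDl scalerA.
by rewrite linearP scalerDr !scalerA mulrC.
Qed.

Definition untwist_lin : {linear T -> ffun_mod M} :=
  mklin (tprod_ev_linear untwist_bilinear).

Lemma untwist_pure r x : untwist_lin (pure r x) = untwist r x.
Proof. exact: tprod_ev_pure untwist_bilinear. Qed.

Lemma untwist_act g x : untwist_lin (act g x) = act g (untwist_lin x).
Proof.
rewrite (tprod_sum_pure x) (linear_sum (@act _ _ T g)).
rewrite !(linear_sum untwist_lin) (linear_sum (@act _ _ (ffun_mod M) g)).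
apply: eq_bigr => z _; rewrite tens_act_pure !untwist_pure; apply/ffunP => h; rewrite !ffunE.
by rewrite linearZ_LR -actM mulKVg.
Qed.

Definition delta (h : G) : regular := [ffun k => (k == h)%:R : R].

Definition retwist (f : ffun_mod M) : T :=
  \sum_h pure (delta h) (act h^-1%g (f h) : triv (fgmod_fin_gen M)).

Lemma retwist_linear : linear retwist.
Proof.
move=> a f f'; have [_ pr] := @pure_bilinear R regular M.
rewrite /retwist scaler_sumr -big_split; apply: eq_bigr => h _.
by rewrite !ffunE linearP /= pr.
Qed.

Lemma untwistK : cancel untwist_lin retwist.
Proof.
have [pl pr] := @pure_bilinear R regular M.
have pD r : linear (fun x : M => pure r x : T) by move=> a x y; exact: pr.
have pl' y : linear (fun r => pure r y : T) by move=> a r r'; exact: pl.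
move=> x; rewrite (tprod_sum_pure x) linear_sum.
rewrite -[LHS](mklinE retwist_linear) linear_sum; apply: eq_bigr => -[r m] _.
rewrite mklinE untwist_pure /retwist /=.
transitivity (\sum_h mklin (pl' m) (r h *: delta h)).
  apply: eq_bigr => h _; rewrite !linearZ_LR mklinE ffunE linearZ_LR -actM.
  by rewrite mulVg act1 -[LHS](mklinE (pD (delta h))) linearZ_LR.
rewrite -linear_sum mklinE; congr (pure _ _); apply/ffunP => k.
rewrite sum_ffunE (bigD1 k) //= big1 ?addr0 => [|h hk].
  by rewrite !ffunE eqxx /GRing.scale /= mulr1.
by rewrite !ffunE eq_sym (negPf hk) scaler0.
Qed.

Lemma retwistK : cancel retwist untwist_lin.
Proof.
move=> f; rewrite /retwist (linear_sum untwist_lin); apply/ffunP => k.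
rewrite sum_ffunE (bigD1 k) //= big1 ?addr0 => [|h hk].
  by rewrite (tprod_ev_pure _ _ untwist_bilinear) !ffunE eqxx scale1r -actM mulgV act1.
by rewrite (tprod_ev_pure _ _ untwist_bilinear) !ffunE eq_sym (negPf hk) scale0r.
Qed.

Lemma retwist_act g f :
  mklin retwist_linear (act g f) = act g (mklin retwist_linear f).
Proof.
apply: (can_inj untwistK); rewrite untwist_act.
transitivity (act g f); first exact: retwistK.
by congr (act g _); symmetry; exact: retwistK.
Qed.

Lemma ffun_mod_weakly_projective : weakly_projective (ffun_mod M).
Proof.
exists M, (fgmod_fin_gen M), zero_mod.
exists (ghom_comp (GHom retwist_act) (ghom_fst _ _)).
exists (ghom_comp (ghom_inl _ _) (GHom untwist_act)); split=> [[f z]|x].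
  by congr (_, _); [exact: retwistK|apply/rowP => -[]].
exact: untwistK.
Qed.

Lemma shift_exact : R_split_exact (const_hom M) (shift_proj M).
Proof.
split.
- by move=> x y /ffunP /(_ 1%g); rewrite !ffunE.
- move=> f; rewrite -[X in _ = X](linear0 (shift_proj M)); split.
    by move/coker_piP => [x]; rewrite subr0; exists x.
  by case=> x ->; apply/coker_piP; exists x; rewrite subr0.
- exact: coker_pi_surj.
- pose f0 (f : ffun_mod M) : ffun_mod M := f - const_hom M (f 1%g).
  have f0D f f' : f0 (f - f') = f0 f - f0 f'.
    by apply/ffunP => h; rewrite !ffunE !opprD !opprK addrACA.
  have f0_pi f f' : shift_proj M f = shift_proj M f' -> f0 f = f0 f'.
    move=> /coker_piP [x hx]; apply/subr0_eq; rewrite -f0D hx.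
    by apply/ffunP => h; rewrite !ffunE subrr.
  pose s (q : shift M) := f0 (repr q).
  have sE f : s (shift_proj M f) = f0 f by apply: f0_pi; exact: reprK.
  have sl : linear s.
    move=> a q q'; have [f ->] := coker_pi_surj q.
    have [f' ->] := coker_pi_surj q'.
    rewrite -[_ *: _ + _](linearP (shift_proj M)) !sE.
    by apply/ffunP => h; rewrite !ffunE scalerBr opprD addrACA.
  exists (mklin sl) => q; rewrite mklinE; have [f ->] := coker_pi_surj q.
  rewrite sE; apply/coker_piP; exists (- f 1%g).
  by rewrite linearN addrAC subrr add0r.
Qed.

End ShiftSequence.

Definition strel : ttcat := @TTCat (fgmod R G) ghom ghom_eqv ghom_id ghom_comp
  zero_mod dsum shift distinguished tens distinguished_dsum.

End RGModules.

(* Main.v *)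
(* Let R = S/t^n and, for j < n, let F_j(M) = t^j M / t^(j+1) M, a kG-module.  A
   finitely generated R-module is a direct sum of modules R/t^i, so F_j is a tensor
   functor; it preserves R-split exact sequences and stable equality, hence pulls
   primes of stmod kG back to primes of strel RG.

   Conversely let P be a prime of strel RG.  There is a unique j < n such that
   R/t^j, but not R/t^(j+1), belongs to P; then P contains the modules killed by
   t^j, and M belongs to P if and only if M / t^(j+1) M does.  If M and N are killed
   by t^(j+1) and F_j(M) = V = F_j(N), glue them along their common submodule
   t^j M = V = t^j N: any R-linear map F_j(M) -> F_j(N) lifts to an R-linear map
   M -> N, so the pushout is an R-split extension of N / t^j N by M, and also of
   M / t^j M by N.  Hence M and N belong to P simultaneously and P is the preimage
   under F_j of Q = {F_j(M) : M in P}.  That Q is a prime follows because every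
   kG-module, and every short exact sequence of them, lifts through F_j.

   The n images are separated by the modules R/t^i and the cones of R -> R/t^i, so
   that the resulting bijection is a homeomorphism. *)

Require Import Defs.
From HB Require Import structures.
From mathcomp Require Import fingroup.
From mathcomp Require Import all_boot all_order all_algebra.
From mathcomp Require Import boolp.

Set Implicit Arguments.
Unset Strict Implicit.
Unset Printing Implicit Defensive.

Import GRing.Theory.
Local Open Scope ring_scope.

(** * The stable category *)

Definition mkghom (R : comPzRingType) (G : finGroupType) (M N : fgmod R G)
    (f : M -> N) (lf : linear f)
    (af : forall g x, f (act g x) = act g (f x)) : ghom M N :=
  @GHom R G M N (mklin lf) af.

Section StableCategory.
Variables (R : comPzRingType) (G : finGroupType).
Implicit Types (L M N X Y Z W : fgmod R G) (P : fgmod R G -> Prop).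

Lemma actVK M g : cancel (act g^-1%g : M -> M) (act g).
Proof. by move=> x; rewrite -actM mulgV act1. Qed.

Lemma bij_fgmod_iso M N (f : ghom M N) :
  (forall x, f x = 0 -> x = 0) -> (forall y, exists x, f x = y) ->
  fgmod_iso M N.
Proof.
move=> f_inj f_surj; have [h hK] := choice f_surj.
have fK : cancel f h.
  by move=> x; apply/subr0_eq/f_inj; rewrite linearB hK subrr.
have hl : linear h by move=> a x y; apply: (can_inj fK); rewrite linearP !hK.
have ha g x : h (act g x) = act g (h x).
  by apply: (can_inj fK); rewrite ghom_act !hK.
by exists f, (mkghom hl ha).
Qed.

Lemma fgmod_iso_sym M N : fgmod_iso M N -> fgmod_iso N M.
Proof. by move=> [f [h [fK hK]]]; exists h, f. Qed.

(** * Transfer and Higman's criterion *)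

Definition trace M N (u : {linear M -> N}) (x : M) : N :=
  \sum_g act g (u (act g^-1%g x)).

Lemma trace_comp L M N K (f : ghom N K) (u : {linear M -> N}) (h : ghom L M) x :
  f (trace u (h x)) = trace (f \o u \o h : {linear L -> K}) x.
Proof.
rewrite /trace linear_sum; apply: eq_bigr => g _.
by rewrite ghom_act /= ghom_act.
Qed.

Lemma trace_opp M N (u : {linear M -> N}) :
  exists v : {linear M -> N}, forall x, trace v x = - trace u x.
Proof.
have lv : linear (fun x => - u x).
  by move=> a x y; rewrite linearP opprD scalerN.
exists (mklin lv) => x; rewrite /trace -sumrN; apply: eq_bigr => g _.
by rewrite -linearN.
Qed.

Section FactorTrace.
Variables (M N : fgmod R G) (u : {linear M -> N}).

(** An equivariant extension of [trace u] along [const_hom M]. Its source is weakly projective, so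
    every trace vanishes in the stable category. *)
Definition trace_in (f : ffun_mod M) : N := \sum_g act g (u (act g^-1%g (f g))).

Lemma trace_in_linear : linear trace_in.
Proof.
move=> a f f'; rewrite /trace_in scaler_sumr -big_split; apply: eq_bigr => g _.
by rewrite !ffunE !linearP.
Qed.

Lemma trace_in_act g f : trace_in (act g f) = act g (trace_in f).
Proof.
rewrite /trace_in linear_sum (reindex_inj (mulgI g)); apply: eq_bigr => h _ /=.
by rewrite !ffunE invMg -!actM mulKg mulgKV.
Qed.

Definition trace_hom : ghom (ffun_mod M) N := mkghom trace_in_linear trace_in_act.

Lemma trace_factor x : trace_hom (const_hom M x) = trace u x.
Proof. by apply: eq_bigr => g _; rewrite /= ffunE. Qed.

End FactorTrace.

(** The identity is the sum of the projections onto the components indexed by [G], and these are the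
    conjugates of the projection [u] onto the component of 1. *)
Lemma ffun_mod_trace M :
  exists u : {linear ffun_mod M -> ffun_mod M}, forall f, trace u f = f.
Proof.
pose u (f : ffun_mod M) : ffun_mod M := [ffun h => if h == 1%g then f h else 0].
have lu : linear u.
  move=> a f f'; apply/ffunP => h; rewrite !ffunE.
  by case: eqP => // _; rewrite scaler0 addr0.
exists (mklin lu) => f; apply/ffunP => h.
rewrite /trace sum_ffunE (bigD1 h) //= [X in _ + X]big1 ?addr0 => [|g gh].
  by rewrite !ffunE mulVg eqxx mulg1 invgK actVK.
rewrite !ffunE ifF ?linear0 //; apply/negP => /eqP gh1.
by case/eqP: gh; rewrite -[g]mulg1 -gh1 mulKVg.
Qed.

Lemma retract_trace M N (f : ghom M N) (h : ghom N M) (u : {linear N -> N}) :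
  cancel f h -> (forall y, trace u y = y) ->
  exists v : {linear M -> M}, forall x, trace v x = x.
Proof.
move=> fK hu; exists (h \o u \o f : {linear M -> M}) => x.
by rewrite -trace_comp hu fK.
Qed.

(** Untwisting turns the tensor product with [regular] into an [ffun_mod], whose identity is a
    trace; this property passes to direct summands. *)
Lemma weakly_projective_trace W : weakly_projective W ->
  exists u : {linear W -> W}, forall x, trace u x = x.
Proof.
move=> [N [hN [W' [f [h [fK _]]]]]].
have [u hu] := ffun_mod_trace (triv G hN).
have [v hv] : exists v : {linear tens (regular R G) (triv G hN) ->
    tens (regular R G) (triv G hN)}, forall x, trace v x = x.
  pose a : ghom (tens (regular R G) (triv G hN)) (ffun_mod (triv G hN)) :=
    @GHom _ _ (tens (regular R G) (triv G hN)) (ffun_mod (triv G hN))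
      (untwist_lin (triv G hN)) (@untwist_act R G (triv G hN)).
  pose b : ghom (ffun_mod (triv G hN)) (tens (regular R G) (triv G hN)) :=
    @GHom _ _ (ffun_mod (triv G hN)) (tens (regular R G) (triv G hN))
      (mklin (@retwist_linear R G (triv G hN))) (@retwist_act R G (triv G hN)).
  by apply: (@retract_trace _ _ a b _ _ hu); exact: untwistK.
have [w hw] := retract_trace fK hv.
apply: (@retract_trace _ _ (ghom_inl W W') (ghom_fst W W') _ _ hw).
by move=> x.
Qed.

(* Higman's criterion: factoring through a weakly projective module is being the
   trace of an R-linear map.  Traces make sense in terms of R-linear maps only, so
   that any additive functor on R-modules respects stable equality. *)
Lemma ghom_eqvP M N (f f' : ghom M N) :
  ghom_eqv f f' <-> exists u : {linear M -> N}, forall x, f x - f' x = trace u x.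
Proof.
split=> [[W [a [b [wW hab]]]]|[u hu]].
  have [w hw] := weakly_projective_trace wW.
  exists (b \o w \o a : {linear M -> N}) => x.
  by rewrite hab -trace_comp hw.
exists (ffun_mod M), (const_hom M), (trace_hom u).
split; first exact: ffun_mod_weakly_projective.
by move=> x; rewrite trace_factor.
Qed.

(** By Higman's criterion, [h] after [f] is the identity of [M] in the stable category. Keeping the
    R-linear [u] explicit lets the functors F_j act on the relation. *)
Definition stable_retract M N := exists (f : ghom M N) (h : ghom N M)
  (u : {linear M -> M}), forall x, x = h (f x) + trace u x.

Lemma stable_retract_of_iso M N (f : ghom M N) (h : ghom N M) :
  cancel f h -> stable_retract M N.
Proof.
move=> fK; have lz : linear (fun _ : M => 0 : M).
  by move=> a x y; rewrite scaler0 addr0.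
exists f, h, (mklin lz) => x; rewrite fK /trace big1 ?addr0 // => g _.
by rewrite /= linear0.
Qed.

(** Thickness in terms of modules and R-split sequences, without shifts or triangles; [thickP]
    proves it equivalent to [thick]. *)
Record exact_thick P : Prop := ExactThick {
  et_zero : P (zero_mod R G);
  et_retract : forall M N, stable_retract M N -> P N -> P M;
  et_exact : forall L M N (i : ghom L M) (p : ghom M N), R_split_exact i p ->
    [/\ P L -> P M -> P N, P L -> P N -> P M & P M -> P N -> P L] }.

Lemma et_iso P M N : exact_thick P -> fgmod_iso M N -> P M <-> P N.
Proof.
move=> tP [f [h [fK hK]]]; split; apply: (et_retract tP).
  exact: stable_retract_of_iso hK.
exact: stable_retract_of_iso fK.
Qed.

Lemma et_dsum P M N : exact_thick P -> P (dsum M N) <-> P M /\ P N.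
Proof.
move=> tP; split=> [PMN|[PM PN]].
  have sndK : exists f : ghom N (dsum M N), cancel f (ghom_snd M N).
    have lr : linear (fun y : N => (0, y) : dsum M N).
      by move=> a y y'; congr (_, _); rewrite /= scaler0 addr0.
    have ar g y : ((0, act g y) : dsum M N) = act g ((0, y) : dsum M N).
      by congr (_, _); rewrite /= linear0.
    by exists (mkghom lr ar).
  have [f fK] := sndK; split; apply: (et_retract tP) PMN.
    by apply: (@stable_retract_of_iso _ _ (ghom_inl M N) (ghom_fst M N)).
  exact: stable_retract_of_iso fK.
have ex : R_split_exact (ghom_inl M N) (ghom_snd M N).
  split; first by move=> x x' [].
  - move=> [x y]; split=> [/= ->|[x' [_ ->]] //]; by exists x.
  - by move=> y; exists (0, y).
  - have lr : linear (fun y : N => (0, y) : dsum M N).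
      by move=> a y y'; congr (_, _); rewrite /= scaler0 addr0.
    by exists (mklin lr).
by have [_ H _] := et_exact tP ex; exact: H.
Qed.

(** The identity of [ffun_mod M] is a trace, which makes this module a stable retract of zero. *)
Lemma et_ffun_mod P M : exact_thick P -> P (ffun_mod M).
Proof.
move=> tP; apply: (et_retract tP) (et_zero tP).
have [u hu] := ffun_mod_trace M.
exists (ghom_zero _ _), (ghom_zero _ _), u => f.
by rewrite hu /= add0r.
Qed.

Lemma et_null P M : exact_thick P -> (forall x : M, x = 0) -> P M.
Proof.
move=> tP M0; apply: (et_retract tP) (et_zero tP).
apply: (@stable_retract_of_iso _ _ (ghom_zero _ _) (ghom_zero _ _)) => x.
by rewrite [RHS]M0.
Qed.

Lemma exact_retraction L M N (i : ghom L M) (p : ghom M N) :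
  R_split_exact i p -> exists r : {linear M -> L}, cancel i r.
Proof.
move=> [i_inj ker_p p_surj [s sK]].
have /choice [r hr] : forall y, exists x, y - s (p y) = i x.
  by move=> y; apply/ker_p; rewrite linearB sK subrr.
have lr : linear r.
  move=> a y y'; apply: i_inj; rewrite [RHS]linearP -!hr [p _]linearP [s _]linearP.
  by rewrite scalerBr opprD addrACA.
have pi x : p (i x) = 0 by apply/ker_p; exists x.
by exists (mklin lr) => x; apply: i_inj; rewrite -hr pi linear0 subr0.
Qed.

Lemma exact_of_retraction L M N (i : ghom L M) (p : ghom M N)
    (r : {linear M -> L}) :
  cancel i r -> (forall y, p y = 0 <-> exists x, y = i x) ->
  (forall z, exists y, z = p y) -> R_split_exact i p.
Proof.
move=> iK ker_p p_surj; split=> //; first exact: can_inj iK.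
have /choice [s0 hs0] := p_surj.
have pi x : p (i x) = 0 by apply/ker_p; exists x.
(* The correction by [r] removes the choice made in [s0]: [s (p y)] is [y - i (r y)], which is
   linear in [y]. *)
pose s z := s0 z - i (r (s0 z)).
have sE y : s (p y) = y - i (r y).
  have /ker_p [x hx] : p (s0 (p y) - y) = 0 by rewrite linearB -hs0 subrr.
  have -> : s (p y) = (y + i x) - i (r (y + i x)).
    by rewrite -hx [y + _]addrC subrK.
  by rewrite [r _]linearD iK [i (_ + _)]linearD opprD addrACA subrr addr0.
have ls : linear s.
  move=> a z z'; have [y ->] := p_surj z; have [y' ->] := p_surj z'.
  rewrite -[_ *: p y + _]linearP !sE [r _]linearP [i _]linearP.
  by rewrite scalerBr opprD addrACA.
exists (mklin ls) => z; have [y ->] := p_surj z.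
by rewrite mklinE sE linearB pi subr0.
Qed.

(** [ffun_mod L] is coinduced, hence injective relative to R-split sequences: the R-linear
    retraction [r] yields the equivariant [u] extending [const_hom L] along [i]. *)
Lemma exact_connecting L M N (i : ghom L M) (p : ghom M N) :
  R_split_exact i p -> exists w : ghom N (shift L), connecting i p w.
Proof.
move=> ex; have [r rK] := exact_retraction ex.
have [i_inj ker_p p_surj _] := ex.
pose u (y : M) : ffun_mod L := [ffun h => act h (r (act h^-1%g y))].
have lu : linear u.
  by move=> a y y'; apply/ffunP => h; rewrite !ffunE !linearP.
have au g y : u (act g y) = act g (u y).
  apply/ffunP => h; rewrite !ffunE -!actM mulKVg.
  by rewrite invMg invgK.
pose uh : ghom M (ffun_mod L) := mkghom lu au.
have ui x : uh (i x) = const_hom L x.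
  by apply/ffunP => h; rewrite !ffunE -ghom_act rK actVK.
have /choice [w0 hw0] := p_surj.
pose w z := shift_proj L (uh (w0 z)).
have wE y : w (p y) = shift_proj L (uh y).
  have /ker_p [x hx] : p (w0 (p y) - y) = 0 by rewrite linearB -hw0 subrr.
  by apply/coker_piP; exists x; rewrite -linearB hx ui.
have lw : linear w.
  move=> a z z'; have [y ->] := p_surj z; have [y' ->] := p_surj z'.
  by rewrite -linearP !wE !linearP.
have aw g z : w (act g z) = act g (w z).
  by have [y ->] := p_surj z; rewrite -ghom_act !wE !ghom_act.
by exists (mkghom lw aw), uh.
Qed.

Lemma exact_distinguished L M N (i : ghom L M) (p : ghom M N) :
  R_split_exact i p -> exists w, distinguished i p w.
Proof.
move=> ex; have [w cw] := exact_connecting ex; exists w, L, M, N, i, p, w.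
split=> //; exists (ghom_id _), (ghom_id _), (ghom_id _), (ghom_id _).
split; try exact: ghom_eqv_ext.
split; try exact: stable_iso_id.
by move=> x; congr (shift_proj L _); apply/ffunP => h; rewrite ffunE.
Qed.

Lemma tt_iso_of_fgmod_iso M N : fgmod_iso M N -> @tt_iso (strel R G) M N.
Proof.
move=> [f [h [fK hK]]]; exists f, h.
by split; apply: ghom_eqv_ext => x; [exact: fK|exact: hK].
Qed.

(** The complement is the cokernel of [i], and [z] corresponds to [q z] together with its class. *)
Lemma retract_summand M N (i : ghom M N) (q : ghom N M) :
  cancel i q -> exists C, fgmod_iso (dsum M C) N.
Proof.
move=> iK.
have lw : linear (fun z => (q z, coker_proj i z) : dsum M (coker_mod i)).
  by move=> a z z'; rewrite !linearP.
have aw g z : ((q (act g z), coker_proj i (act g z)) : dsum M (coker_mod i)) =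
    act g ((q z, coker_proj i z) : dsum M (coker_mod i)).
  by rewrite !ghom_act.
exists (coker_mod i); apply: fgmod_iso_sym.
apply: (@bij_fgmod_iso _ _ (mkghom lw aw)) => [z [qz pz]|[x y]].
  have : coker_proj i z = coker_proj i 0 by rewrite linear0.
  by move/coker_piP => [x]; rewrite subr0 => zx; rewrite zx -(iK x) -zx qz linear0.
have [z ->] := coker_pi_surj y.
exists (z - i (q z) + i x); congr (_, _).
  by rewrite -[LHS]/(q (z - i (q z) + i x)) linearD linearB !iK subrr add0r.
apply/coker_piP; exists (x - q z).
by rewrite addrAC [z - _]addrC addrK addrC -linearB.
Qed.

Section PairHom.
Variables (M N K : fgmod R G).

Lemma pair_linear (f : ghom K M) (h : ghom K N) :
  linear (fun x => (f x, h x) : dsum M N).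
Proof. by move=> a x y; rewrite !linearP. Qed.

Lemma pair_act (f : ghom K M) (h : ghom K N) g x :
  ((f (act g x), h (act g x)) : dsum M N) = act g ((f x, h x) : dsum M N).
Proof. by rewrite !ghom_act. Qed.

Definition pair_hom f h : ghom K (dsum M N) :=
  mkghom (pair_linear f h) (pair_act f h).

Lemma copair_linear (f : ghom M K) (h : ghom N K) :
  linear (fun z : dsum M N => f z.1 + h z.2).
Proof. by move=> a z z'; rewrite /= !linearP scalerDr addrACA. Qed.

Lemma copair_act (f : ghom M K) (h : ghom N K) g (z : dsum M N) :
  f (act g z).1 + h (act g z).2 = act g (f z.1 + h z.2).
Proof. by rewrite /= linearD !ghom_act. Qed.

Definition copair_hom f h : ghom (dsum M N) K :=
  mkghom (copair_linear f h) (copair_act f h).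

End PairHom.

(** The trace term factors through [ffun_mod M]; adding this module to [N] turns the stable retract
    into a genuine one. *)
Lemma stable_retract_summand M N : stable_retract M N ->
  exists C, fgmod_iso (dsum M C) (dsum N (ffun_mod M)).
Proof.
move=> [f [h [u hu]]].
apply: (@retract_summand _ _ (pair_hom f (const_hom M))
  (copair_hom h (trace_hom u))) => x.
by rewrite [RHS]hu -trace_factor.
Qed.

(** From left to right, a stable retract of [N] is a summand of [N] plus a stably zero [ffun_mod],
    and R-split sequences give triangles. From right to left, a triangle is replaced by its R-split
    sequence up to stable isomorphism, and [shift_exact] handles shifts. *)
Lemma thickP P : @thick (strel R G) P <-> exact_thick P.
Proof.
split=> tP.
  have iso M N : fgmod_iso M N -> P M -> P N.
    by move/tt_iso_of_fgmod_iso/(thick_iso tP); apply.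
  have dsumP M N : P M -> P N -> P (dsum M N).
    have [f [g [h d]]] := distinguished_dsum M N.
    by have [_ H _] := thick_tri tP d; exact: H.
  have ffunP M : P (ffun_mod M).
    apply: (thick_iso tP _ (thick_zero tP)).
    have [u hu] := ffun_mod_trace M.
    exists (ghom_zero _ _), (ghom_zero _ _); split.
      by apply: ghom_eqv_ext => x; apply/rowP => -[].
    have [v hv] := trace_opp u.
    by apply/ghom_eqvP; exists v => x; rewrite hv hu sub0r.
  split; first exact: thick_zero tP.
  - move=> M N /stable_retract_summand [C] /fgmod_iso_sym/iso H PN.
    by have /(thick_summand tP) [] := H (dsumP _ _ PN (ffunP M)).
  - by move=> L M N i p /exact_distinguished [w] /(thick_tri tP).
have iso M N (f : ghom M N) : stable_iso f -> P M <-> P N.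
  move=> [h [/ghom_eqvP [u hu] /ghom_eqvP [v hv]]].
  have neg (X Y : fgmod R G) (a : ghom X Y) (b : ghom Y X)
      (w : {linear X -> X}) :
      (forall x, b (a x) - x = trace w x) -> stable_retract X Y.
    have [w' hw'] := trace_opp w; move=> hw; exists a, b, w' => x.
    by rewrite hw' -hw opprB addrC subrK.
  split; apply: (et_retract tP).
    exact: (neg _ _ h f v).
  exact: (neg _ _ f h u).
have shiftP M : P (shift M) <-> P M.
  have [H1 _ H2] := et_exact tP (shift_exact M).
  by split=> [PM|PM]; [apply: H2|apply: H1] => //; exact: et_ffun_mod.
split=> //.
- exact: et_zero tP.
- move=> M N [f [h fh]]; have sf : stable_iso f by exists h.
  exact: (iso M N f sf).1.
- move=> X Y Z f g h [L [M [N [i [p [w [ex _]]]]]]].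
  move=> [a [b [c [s [[sa sb sc _] _ _ _]]]]].
  have [H1 H2 H3] := et_exact tP ex.
  have [a1 a2] := iso _ _ a sa; have [b1 b2] := iso _ _ b sb.
  have [c1 c2] := iso _ _ c sc.
  by split=> [/a1 HX /b1 HY|/a1 HX /c1 HZ|/b1 HY /c1 HZ]; auto.
- by move=> M N /(et_dsum _ _ tP).
Qed.

End StableCategory.

(** * Quotients with change of scalars *)

Record is_submod (R : comPzRingType) (M : lmodType R) (U : M -> Prop) : Prop :=
  IsSubmod {
    submod0 : U 0;
    submodL : forall a x y, U x -> U y -> U (a *: x + y) }.

Definition semilinear (R k : comPzRingType) (phi : {rmorphism R -> k})
    (M : lmodType R) (V : lmodType k) (f : M -> V) :=
  forall a x y, f (a *: x + y) = phi a *: f x + f y.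

Section Semilinear.
Variables (R k : comPzRingType) (phi : {rmorphism R -> k}).
Variables (M : lmodType R) (V : lmodType k) (f : M -> V).
Hypothesis lf : semilinear phi f.

Lemma semilinearD x y : f (x + y) = f x + f y.
Proof. by rewrite -[x]scale1r lf rmorph1 !scale1r. Qed.

Lemma semilinear0 : f 0 = 0.
Proof. by apply/(addrI (f 0)); rewrite -semilinearD !addr0. Qed.

Lemma semilinearZ a x : f (a *: x) = phi a *: f x.
Proof. by rewrite -[a *: x]addr0 lf semilinear0 addr0. Qed.

Lemma semilinearN x : f (- x) = - f x.
Proof. by rewrite -scaleN1r semilinearZ rmorphN1 scaleN1r. Qed.

Lemma semilinearB x y : f (x - y) = f x - f y.
Proof. by rewrite semilinearD semilinearN. Qed.

Lemma semilinear_sum (I : Type) (r : seq I) (P : pred I) (F : I -> M) :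
  f (\sum_(i <- r | P i) F i) = \sum_(i <- r | P i) f (F i).
Proof.
by elim/big_rec2: _ => [|i x y _ <-]; rewrite ?semilinear0 ?semilinearD.
Qed.

End Semilinear.

Section ScalarQuotient.
Local Open Scope quotient_scope.
Variables (R k : comPzRingType) (phi : {rmorphism R -> k}) (rho : k -> R).
Hypothesis rhoK : cancel rho phi.
Variables (M : lmodType R) (U : M -> Prop).
Hypothesis subU : is_submod U.
Hypothesis phiU : forall a x, phi a = 0 -> U (a *: x).

Definition sq_pred : {pred M} := fun x => `[< U x >].

Lemma sq_pred_zmod_closed : zmod_closed sq_pred.
Proof.
split; first by apply/asboolP; exact: submod0.
move=> x y /asboolP Ux /asboolP Uy; apply/asboolP.
by rewrite addrC -scaleN1r; exact: submodL.
Qed.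

HB.instance Definition _ :=
  GRing.isZmodClosed.Build M sq_pred sq_pred_zmod_closed.

Definition squot := Quotient.quot sq_pred.
HB.instance Definition _ := GRing.Zmodule.on squot.
HB.instance Definition _ := EqQuotient.on squot.

Lemma squot_piP x y : \pi_squot x = \pi_squot y <-> U (x - y).
Proof.
split=> [/eqP|]; first by rewrite -Quotient.idealrBE => /asboolP.
by move=> h; apply/eqP; rewrite -Quotient.idealrBE; apply/asboolP.
Qed.

Lemma squot_piD x y : \pi_squot x + \pi_squot y = \pi_squot (x + y).
Proof. by symmetry; exact: (Quotient.pi_add sq_pred). Qed.

(** The scalar [c] acts through its chosen lift [rho c]; by [phiU] every other lift acts in the same
    way, see [squot_piZ]. *)
Definition squot_scale (c : k) := lift_op1 squot ( *:%R (rho c)).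

Lemma squot_piZ a x : squot_scale (phi a) (\pi_squot x) = \pi_squot (a *: x).
Proof.
unlock squot_scale; apply/squot_piP.
have Ud : U (repr (\pi_squot x) - x) by apply/squot_piP; rewrite reprK.
set y := repr _ in Ud *.
have -> : rho (phi a) *: y - a *: x = a *: (y - x) + (rho (phi a) - a) *: y.
  by rewrite scalerBr scalerBl [RHS]addrC subrKA.
apply: submodL => //.
by apply: phiU; rewrite rmorphB rhoK subrr.
Qed.

Lemma squot_piZr c x : squot_scale c (\pi_squot x) = \pi_squot (rho c *: x).
Proof. by rewrite -{1}(rhoK c) squot_piZ. Qed.

Lemma squot_scaleA a b v :
  squot_scale a (squot_scale b v) = squot_scale (a * b) v.
Proof.
rewrite -[v]reprK !squot_piZr scalerA.
by rewrite -[LHS]squot_piZ rmorphM !rhoK squot_piZr.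
Qed.

Lemma squot_scale1 : left_id 1 squot_scale.
Proof. by move=> v; rewrite -[v]reprK -(rmorph1 phi) squot_piZ scale1r. Qed.

Lemma squot_scaleDr : right_distributive squot_scale +%R.
Proof.
move=> a x y; rewrite -[x]reprK -[y]reprK.
by rewrite squot_piD !squot_piZr squot_piD scalerDr.
Qed.

Lemma squot_scaleDl v : {morph squot_scale^~ v : a b / a + b}.
Proof.
move=> a b; rewrite /= -[v]reprK !squot_piZr squot_piD -scalerDl.
by rewrite -[RHS]squot_piZ rmorphD !rhoK squot_piZr.
Qed.

HB.instance Definition _ := GRing.Zmodule_isLmodule.Build k squot
  squot_scaleA squot_scale1 squot_scaleDr squot_scaleDl.

Lemma squot_exists : exists (D : lmodType k) (q : M -> D),
  [/\ semilinear phi q, forall d, exists x, d = q x &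
      forall x, q x = 0 <-> U x].
Proof.
exists squot, (fun x => \pi_squot x); split=> [a x y|d|x].
- by rewrite -squot_piD -squot_piZ.
- by exists (repr d); rewrite reprK.
- have {2}-> : x = x - 0 by rewrite subr0.
  rewrite -squot_piP; have -> : \pi_squot 0 = 0 :> squot; last by [].
  by apply: (addrI (\pi_squot 0)); rewrite squot_piD !addr0.
Qed.

End ScalarQuotient.

Section QuotientMaps.
Variables (R k : comPzRingType) (phi : {rmorphism R -> k}) (G : finGroupType).

(** [q] exhibits [D] as M / U with scalars changed along [phi]. The residue map as [phi] gives the
    layers of a module, the identity gives plain quotients of RG-modules. *)
Record quotient_map (M : fgmod R G) (D : fgmod k G) (U : M -> Prop)
    (q : M -> D) : Prop := QuotientMap {
  qm_lin : semilinear phi q;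
  qm_act : forall g x, q (act g x) = act g (q x);
  qm_surj : forall d, exists x, d = q x;
  qm_ker : forall x, q x = 0 <-> U x }.

Lemma quotient_map_exists (M : fgmod R G) (U : M -> Prop) :
  (forall c, exists a, phi a = c) -> is_submod U ->
  (forall g x, U x -> U (act g x)) -> (forall a x, phi a = 0 -> U (a *: x)) ->
  exists (D : fgmod k G) (q : M -> D), quotient_map U q.
Proof.
move=> /choice [rho rhoK] subU actU phiU.
have [D [q [ql qs qk]]] := squot_exists rhoK subU phiU.
have qP x y : q x = q y <-> U (x - y).
  by rewrite -qk (semilinearB ql); split=> [->|/subr0_eq]; rewrite ?subrr.
have /choice [r hr] := qs.
pose f g d := q (act g (r d)).
have fE g x : f g (q x) = q (act g x).
  by apply/qP; rewrite -linearB; apply/actU/qP; rewrite -hr.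
have lf g : linear (f g).
  move=> c d d'; have [x ->] := qs d; have [y ->] := qs d'.
  by rewrite -(rhoK c) -ql !fE linearP ql.
have f1 : mklin (lf 1%g) =1 id.
  by move=> d; have [x ->] := qs d; rewrite mklinE fE act1.
have fM g h d : mklin (lf (g * h)%g) d = mklin (lf g) (mklin (lf h) d).
  by have [x ->] := qs d; rewrite !mklinE !fE actM.
have [I [s hs]] := fgmod_spans M.
have fg : exists (m : nat) (s : 'I_m -> D), forall x,
    exists c : 'I_m -> G -> k, x = \sum_i \sum_g c i g *: mklin (lf g) (s i).
  apply: (@spans_fg _ _ _ (fun g => mklin (lf g)) _ (q \o s) f1) => d.
  have [x ->] := qs d; have [c ->] := hs x; exists (phi \o c).
  by rewrite (semilinear_sum ql); apply: eq_bigr => i _; rewrite (semilinearZ ql).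
exists (@FGMod k G D (fun g => mklin (lf g)) f1 fM fg), q; split=> // g x.
by rewrite /= fE.
Qed.

Section Factor.
Variables (M : fgmod R G) (D : fgmod k G) (U : M -> Prop) (q : M -> D).
Hypothesis phi_surj : forall c, exists a, phi a = c.
Hypothesis qP : quotient_map U q.

Lemma qm_eq x y : q x = q y <-> U (x - y).
Proof.
rewrite -(qm_ker qP) (semilinearB (qm_lin qP)).
by split=> [->|]; [rewrite subrr|move/subr0_eq].
Qed.

Lemma qm_factor (N : lmodType k) (f : M -> N) : semilinear phi f ->
  (forall x, U x -> f x = 0) ->
  exists h : {linear D -> N}, forall x, h (q x) = f x.
Proof.
move=> lf fU; have /choice [r hr] := qm_surj qP.
have hE x : f (r (q x)) = f x.
  by apply/subr0_eq; rewrite -(semilinearB lf); apply/fU/qm_eq; rewrite -hr.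
have lh : linear (fun d => f (r d)).
  move=> c d d'; have [a <-] := phi_surj c.
  have [x ->] := qm_surj qP d; have [y ->] := qm_surj qP d'.
  by rewrite -(qm_lin qP) !hE lf.
by exists (mklin lh).
Qed.

Lemma qm_factor_hom (N : fgmod k G) (f : M -> N) : semilinear phi f ->
  (forall g x, f (act g x) = act g (f x)) -> (forall x, U x -> f x = 0) ->
  exists h : ghom D N, forall x, h (q x) = f x.
Proof.
move=> lf af fU; have [h hE] := qm_factor lf fU.
have ah g d : h (act g d) = act g (h d).
  by have [x ->] := qm_surj qP d; rewrite -(qm_act qP) !hE af.
by exists (GHom ah).
Qed.

End Factor.

Lemma quotient_map_iso (M : fgmod R G) (D D' : fgmod k G) (U : M -> Prop)
    (q : M -> D) (q' : M -> D') :
  (forall c, exists a, phi a = c) -> quotient_map U q -> quotient_map U q' ->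
  exists h : ghom D D', (forall x, h (q x) = q' x) /\ fgmod_iso D D'.
Proof.
move=> ps qP qP'.
have [h hE] := qm_factor_hom ps qP (qm_lin qP') (qm_act qP')
  (fun x => (qm_ker qP' x).2).
exists h; split=> //; apply: (@bij_fgmod_iso _ _ _ _ h) => [d|d].
  have [x ->] := qm_surj qP d.
  by rewrite hE => /(qm_ker qP')/(qm_ker qP).
by have [x ->] := qm_surj qP' d; exists (q x).
Qed.

Lemma quotient_map_comp (M : fgmod R G) (D D' : fgmod k G) (U : M -> Prop)
    (q : M -> D) : quotient_map U q -> fgmod_iso D D' ->
  exists q' : M -> D', quotient_map U q'.
Proof.
move=> qP [f [h [fK hK]]]; exists (f \o q); split=> [a x y|g x|d|x] /=.
- by rewrite (qm_lin qP) linearP.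
- by rewrite (qm_act qP) ghom_act.
- by have [x hx] := qm_surj qP (h d); exists x; rewrite -hx hK.
- rewrite -(qm_ker qP); split=> [|->]; last by rewrite linear0.
  by move/(congr1 h); rewrite fK linear0.
Qed.

End QuotientMaps.

(** * Modules over a truncated discrete valuation ring *)

(** What the argument uses of S/t^n and its residue map [phi]; [dvr_truncated] provides it. Every
    element is a unit times a power of [tau], zero being covered by [tau ^+ n], and [td_ann]
    describes the annihilators of the powers of [tau]. *)
Record truncated_dvr (R k : comPzRingType) (phi : {rmorphism R -> k})
    (tau : R) (n : nat) : Prop := TruncatedDvr {
  td_surj : forall c, exists a, phi a = c;
  td_ker : forall a, phi a = 0 <-> exists b, a = tau * b;
  td_nil : tau ^+ n = 0;
  td_val : forall a, exists b u v, u * v = 1 /\ a = u * tau ^+ b;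
  td_ann : forall m a, (m <= n)%N -> tau ^+ m * a = 0 ->
    exists b, a = tau ^+ (n - m) * b }.

Section TruncatedDvr.
Variables (R k : comPzRingType) (phi : {rmorphism R -> k}) (tau : R) (n : nat).
Hypothesis tdR : truncated_dvr phi tau n.

(** A decomposition of [M] as the direct sum of the cyclic modules generated by the [x i], each
    isomorphic to R / tau^(o i). Zero generators, with [o i = 0], are allowed. *)
Definition order_basis (M : lmodType R) (m : nat) (x : 'I_m -> M)
    (o : 'I_m -> nat) :=
  [/\ spans x, forall i, tau ^+ o i *: x i = 0 &
      forall c, \sum_i c i *: x i = 0 -> forall i, exists d, c i = tau ^+ o i * d].

Lemma spans_exchange (M : lmodType R) (m : nat) (x : 'I_m -> M) i0 (e : 'I_m -> R) :
  spans x -> e i0 = 1 ->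
  spans (fun i => if i == i0 then \sum_i e i *: x i else x i).
Proof.
move=> sx e1 y; have [c ->] := sx y.
exists (fun i => if i == i0 then c i0 else c i - c i0 * e i).
rewrite (bigD1 i0) //= [RHS](bigD1 i0) //= !eqxx.
rewrite [\sum_i e i *: x i](bigD1 i0) //= e1 scale1r.
rewrite scalerDr -addrA scaler_sumr -big_split; congr (_ + _).
by apply: eq_bigr => i /negPf ->; rewrite scalerBl scalerA [RHS]addrC subrK.
Qed.

(* A nontrivial relation, divided by the smallest power of [tau] occurring in
   it, replaces a generator by one of smaller order. *)
Lemma order_basis_exists (M : lmodType R) :
  fin_gen M -> exists m (x : 'I_m -> M) o, order_basis x o.
Proof.
move=> [m [x sx]].
have : exists o : 'I_m -> nat, forall i, tau ^+ o i *: x i = 0.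
  by exists (fun=> n) => i; rewrite (td_nil tdR) scale0r.
case=> o; have [N] := ubnP (\sum_i o i); elim: N x o sx => // N IH x o sx leN xo.
case: (pselect (forall c, \sum_i c i *: x i = 0 ->
    forall i, exists d, c i = tau ^+ o i * d)) => [ind|nind].
  by exists m, x, o.
have [c [c0 [i1 nc]]] : exists c, \sum_i c i *: x i = 0 /\
    exists i, ~ exists d, c i = tau ^+ o i * d.
  apply: contrapT => H; apply: nind => c c0 i; apply: contrapT => nd.
  by apply: H; exists c; split=> //; exists i.
have /choice [b /choice [u /choice [v uvP]]] := fun i => td_val tdR (c i).
have bad1 : (b i1 < o i1)%N.
  rewrite ltnNge; apply/negP => le; apply: nc.
  exists (u i1 * tau ^+ (b i1 - o i1)).
  by rewrite (uvP i1).2 mulrCA -exprD subnKC.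
pose i0 := [arg min_(i < i1 | (b i < o i)%N) b i].
have [bad0 min0] : (b i0 < o i0)%N /\ forall i, (b i < o i)%N -> (b i0 <= b i)%N.
  by rewrite /i0; case: arg_minnP.
(* The relation divided by [u i0 * tau ^+ b i0]. The terms with [o i <= b i] vanish, so that
   dropping them leaves a relation. *)
pose e i := if (b i < o i)%N then v i0 * u i * tau ^+ (b i - b i0) else 0.
have e1 : e i0 = 1.
  by rewrite /e bad0 subnn expr0 mulr1 mulrC (uvP i0).1.
have x'0 : tau ^+ b i0 *: (\sum_i e i *: x i) = 0.
  transitivity (v i0 *: \sum_i c i *: x i); last by rewrite c0 scaler0.
  rewrite !scaler_sumr; apply: eq_bigr => i _.
  rewrite !scalerA (uvP i).2 /e; case: ltnP => [lt|ge].
    congr (_ *: _); rewrite -mulrA mulrCA; congr (_ * _).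
    by rewrite mulrCA -exprD subnKC // min0.
  rewrite mulr0 scale0r -[in tau ^+ b i](subnK ge) exprD !mulrA.
  by rewrite -scalerA xo scaler0.
pose o' i := if i == i0 then b i0 else o i.
apply: (IH _ o' (spans_exchange sx e1)); last first.
  by move=> i; rewrite /o'; case: eqP.
rewrite ltnS in leN; apply: leq_trans leN.
rewrite (bigD1 i0) //= [X in (_ < X)%N](bigD1 i0) //=.
rewrite {1}/o' eqxx -addSn leq_add // leq_eqVlt; apply/orP; left; apply/eqP.
by apply: eq_bigr => i /negPf; rewrite /o' => ->.
Qed.

Section Coordinates.
Variables (M : lmodType R) (m : nat) (x : 'I_m -> M) (o : 'I_m -> nat).
Hypothesis ob : order_basis x o.

(** The i-th coordinate is only determined modulo [tau ^+ o i], so a choice of coordinates is linear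
    only up to multiples of this power. *)
Lemma order_basis_coord : exists c : M -> 'I_m -> R,
  (forall y, y = \sum_i c y i *: x i) /\
  forall a y z i, exists d, c (a *: y + z) i - (a * c y i + c z i) = tau ^+ o i * d.
Proof.
have [sx _ ind] := ob; have /choice [c cE] := sx; exists c; split=> // a y z i.
apply: (ind (fun i => c (a *: y + z) i - (a * c y i + c z i))).
rewrite (eq_bigr (fun j => c (a *: y + z) j *: x j -
    (a *: (c y j *: x j) + c z j *: x j))) => [|j _]; last first.
  by rewrite scalerBl scalerDl scalerA.
by rewrite sumrB big_split -scaler_sumr -!cE subrr.
Qed.

Lemma order_basis_extend (N : lmodType R) (y : 'I_m -> N) :
  (forall i, tau ^+ o i *: y i = 0) ->
  exists f : {linear M -> N}, forall i, f (x i) = y i.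
Proof.
move=> y0; have [c [cE cl]] := order_basis_coord.
have eqy (a b : 'I_m -> R) : \sum_i a i *: x i = \sum_i b i *: x i ->
    \sum_i a i *: y i = \sum_i b i *: y i.
  move=> ab; apply/subr0_eq; rewrite -sumrB big1 // => i _.
  have [_ _ ind] := ob; have [|d hd] := ind (fun i => a i - b i) _ i.
    rewrite (eq_bigr (fun i => a i *: x i - b i *: x i)) => [|j _].
      by rewrite sumrB ab subrr.
    by rewrite scalerBl.
  by rewrite -scalerBl hd mulrC -scalerA y0 scaler0.
have lf : linear (fun z => \sum_i c z i *: y i).
  move=> a z z'; rewrite scaler_sumr -big_split /=.
  rewrite [RHS](eq_bigr (fun i => (a * c z i + c z' i) *: y i)) => [|i _];
      last first.
    by rewrite scalerDl scalerA.
  apply: eqy; rewrite -cE [in LHS](cE z) [in LHS](cE z') scaler_sumr -big_split.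
  by apply: eq_bigr => i _; rewrite scalerDl scalerA.
exists (mklin lf) => i; rewrite mklinE.
rewrite (eqy _ (fun j => (j == i)%:R)); last first.
  rewrite -cE (bigD1 i) //= eqxx scale1r big1 ?addr0 // => j /negPf ->.
  by rewrite scale0r.
rewrite (bigD1 i) //= eqxx scale1r big1 ?addr0 // => j /negPf ->.
by rewrite scale0r.
Qed.

End Coordinates.
End TruncatedDvr.

(** * The layers of a module *)

Section Tensor.
Variables (R : comPzRingType) (M N : lmodType R).

Lemma pure_linear_l (y : N) : linear (fun x : M => pure x y).
Proof. by move=> a x x'; exact: (@pure_bilinear R M N).1. Qed.

Lemma pure_linear_r (x : M) : linear (fun y : N => pure x y).
Proof. by move=> a y y'; exact: (@pure_bilinear R M N).2. Qed.

Lemma pureZl a x (y : N) : pure (a *: x : M) y = a *: pure x y.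
Proof. exact: (linearZ_LR (mklin (pure_linear_l y))). Qed.

Lemma pureZr a (x : M) (y : N) : pure x (a *: y) = a *: pure x y.
Proof. exact: (linearZ_LR (mklin (pure_linear_r x))). Qed.

Lemma pure0l (y : N) : pure (0 : M) y = 0.
Proof. exact: (linear0 (mklin (pure_linear_l y))). Qed.

Lemma pure0r (x : M) : pure x (0 : N) = 0.
Proof. exact: (linear0 (mklin (pure_linear_r x))). Qed.

Lemma pureBl x x' (y : N) : pure (x - x' : M) y = pure x y - pure x' y.
Proof. exact: (linearB (mklin (pure_linear_l y))). Qed.

Lemma pureBr (x : M) (y y' : N) : pure x (y - y') = pure x y - pure x y'.
Proof. exact: (linearB (mklin (pure_linear_r x))). Qed.

Lemma tprod_linear_eq (k : comPzRingType) (phi : {rmorphism R -> k})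
    (L : lmodType k) (f f' : tprod M N -> L) :
  semilinear phi f -> semilinear phi f' ->
  (forall x y, f (pure x y) = f' (pure x y)) -> f =1 f'.
Proof.
move=> lf lf' ff' z; rewrite (tprod_sum_pure z) (semilinear_sum lf).
by rewrite (semilinear_sum lf'); apply: eq_bigr => u _.
Qed.

Lemma tprod_spans (I J : finType) (s : I -> M) (r : J -> N) :
  spans s -> spans r -> spans (fun k : I * J => pure (s k.1) (r k.2)).
Proof.
move=> hs hr z; rewrite (tprod_sum_pure z); apply: spans_sum => -[x y] /=.
have [_ _ PZ Pt] := spans_pred (fun k : I * J => pure (s k.1) (r k.2)).
have [c ->] := hs x; have [d ->] := hr y.
have -> : pure (\sum_i c i *: s i) (\sum_j d j *: r j) =
    \sum_i \sum_j (c i * d j) *: pure (s i) (r j).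
  rewrite -[LHS](mklinE (pure_linear_l _)) linear_sum; apply: eq_bigr => i _.
  rewrite mklinE pureZl -[pure _ _](mklinE (pure_linear_r _)) linear_sum.
  rewrite scaler_sumr; apply: eq_bigr => j _.
  by rewrite linearZ_LR mklinE scalerA.
by apply: spans_sum => i; apply: spans_sum => j; apply: PZ; exact: (Pt (i, j)).
Qed.

End Tensor.

Lemma act_pure (R : comPzRingType) (G : finGroupType) (M N : fgmod R G) g x y :
  act g (pure x y : tens M N) = pure (act g x) (act g y).
Proof. exact: tens_act_pure. Qed.

(** * The layer functors and their compatibility with tensor products *)

Section Reduction.
Variables (R k : comPzRingType) (phi : {rmorphism R -> k}) (tau : R) (n : nat).
Hypothesis tdR : truncated_dvr phi tau n.
Variable G : finGroupType.
Implicit Types (L M N D : fgmod R G) (U V W : fgmod k G).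

(* The quotient of [M] by [layer j M] is isomorphic to t^j M / t^(j+1) M. *)
Definition layer j (M : lmodType R) (x : M) :=
  exists y, tau ^+ j *: x = tau ^+ j.+1 *: y.

(** The functor F_j, encoded as a relation: its value is determined up to isomorphism by
    [reduction_unique], and any model of it may be used. *)
Definition reduction j M V (p : M -> V) := quotient_map phi (@layer j M) p.

Lemma phi_tau : phi tau = 0.
Proof. by apply/(td_ker tdR); exists 1; rewrite mulr1. Qed.

Lemma layer_submod j (M : lmodType R) : is_submod (@layer j M).
Proof.
split=> [|a x y [x' hx] [y' hy]]; first by exists 0; rewrite !scaler0.
exists (a *: x' + y').
by rewrite !scalerDr !scalerA ![_ * a]mulrC -!scalerA hx hy.
Qed.

Lemma layer_linear j (M N : lmodType R) (f : {linear M -> N}) x :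
  layer j x -> layer j (f x).
Proof. by move=> [y hy]; exists (f y); rewrite -!linearZ_LR hy. Qed.

Lemma layer_kill j (M : lmodType R) (x : M) : tau ^+ j *: x = 0 -> layer j x.
Proof. by move=> x0; exists 0; rewrite scaler0. Qed.

Lemma layer_ker j a (M : lmodType R) (x : M) : phi a = 0 -> layer j (a *: x).
Proof.
move=> /(td_ker tdR) [b ->]; exists (b *: x).
by rewrite !scalerA mulrA -exprSr.
Qed.

Lemma reduction_exists j M : exists V (p : M -> V), reduction j p.
Proof.
apply: quotient_map_exists (td_surj tdR) (layer_submod j M) _ _.
- by move=> g x; exact: layer_linear.
- by move=> a x; exact: layer_ker.
Qed.

Lemma reduction_unique j M V W (p : M -> V) (q : M -> W) :
  reduction j p -> reduction j q -> fgmod_iso V W.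
Proof.
move=> pP qP.
by have [h []] := quotient_map_iso (td_surj tdR) pP qP.
Qed.

Section Maps.
Variables (j : nat) (M N : fgmod R G) (V W : fgmod k G) (p : M -> V) (q : N -> W).
Hypotheses (pP : reduction j p) (qP : reduction j q).

Lemma reduction_map (f : {linear M -> N}) :
  exists h : {linear V -> W}, forall x, h (p x) = q (f x).
Proof.
apply: (qm_factor (td_surj tdR) pP (f := q \o f)) => [a x y|x] /=.
  by rewrite linearP (qm_lin qP).
by move/(layer_linear f)/(qm_ker qP).
Qed.

Lemma reduction_map_hom (f : ghom M N) :
  exists h : ghom V W, forall x, h (p x) = q (f x).
Proof.
apply: (qm_factor_hom (td_surj tdR) pP (f := q \o f)) => [a x y|g x|x] /=.
- by rewrite linearP (qm_lin qP).
- by rewrite ghom_act (qm_act qP).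
- by move/(layer_linear f)/(qm_ker qP).
Qed.

(** The lift is chosen on an order basis of [M]. A generator of order at most [j] dies in [V] and
    may go to 0; for one of larger order, any lift of its image is killed by the required power of
    [tau], since [tau ^+ j.+1] kills [N]. *)
Lemma reduction_lift (h : {linear V -> W}) :
  (forall y : N, tau ^+ j.+1 *: y = 0) ->
  exists f : {linear M -> N}, forall x, q (f x) = h (p x).
Proof.
move=> N0; have [m [x [o ob]]] := order_basis_exists tdR (fgmod_fin_gen M).
have /choice [y hy] : forall i, exists y, h (p (x i)) = q y /\ tau ^+ o i *: y = 0.
  move=> i; case: (ltnP j (o i)) => oi.
    have [y hy] := qm_surj qP (h (p (x i))); exists y; split=> //.
    by rewrite -(subnK oi) exprD -scalerA N0 scaler0.
  exists 0; rewrite (semilinear0 (qm_lin qP)) scaler0; split=> //.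
  have -> : p (x i) = 0; last exact: linear0.
  apply/(qm_ker pP)/layer_kill; have [_ x0 _] := ob.
  by rewrite -(subnK oi) exprD -scalerA x0 scaler0.
have [f fE] := order_basis_extend ob (fun i => (hy i).2).
exists f => z; have [sx _ _] := ob; have [c ->] := sx z.
rewrite linear_sum (semilinear_sum (qm_lin qP)) (semilinear_sum (qm_lin pP)).
rewrite linear_sum; apply: eq_bigr => i _.
rewrite linearZ_LR (semilinearZ (qm_lin qP)) (semilinearZ (qm_lin pP)).
by rewrite linearZ_LR fE -(hy i).1.
Qed.

Lemma reduction_dsum :
  reduction j (fun z : dsum M N => (p z.1, q z.2) : dsum V W).
Proof.
split=> [a [x y] [x' y']|g [x y]|[v w]|[x y]].
- by rewrite /= (qm_lin pP) (qm_lin qP).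
- by congr (_, _); rewrite /= ?(qm_act pP) ?(qm_act qP).
- have [x ->] := qm_surj pP v; have [y ->] := qm_surj qP w.
  by exists (x, y).
- split=> [[/(qm_ker pP) [x' hx] /(qm_ker qP) [y' hy]]|[[x' y'] [hx hy]]].
    by exists (x', y'); congr (_, _).
  by congr (_, _); [apply/(qm_ker pP); exists x'|apply/(qm_ker qP); exists y'].
Qed.

End Maps.

(** A relation [tau ^+ j *: d = tau ^+ j.+1 *: d'] in the quotient lifts to [M] up to an element of
    [U], which the right-hand side absorbs. *)
Lemma reduction_quot j M D V (p : M -> V) (U : M -> Prop) (c : M -> D) :
  reduction j p -> quotient_map [the {rmorphism R -> R} of idfun] U c ->
  (forall x, U x -> exists y, x = tau ^+ j.+1 *: y) ->
  exists2 p' : D -> V, reduction j p' & forall x, p' (c x) = p x.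
Proof.
move=> pP cP hU.
have cB x y : c x = c y -> exists z, x - y = tau ^+ j.+1 *: z.
  by move/(qm_eq cP)/hU.
have Up x y : c x = c y -> p x = p y.
  move=> /cB [z hz]; apply/(qm_eq pP); exists (tau ^+ j *: z).
  by rewrite hz !scalerA mulrC.
have /choice [r hr] := qm_surj cP.
have pE x : p (r (c x)) = p x by apply: Up; rewrite -hr.
exists (p \o r) => //; split=> [a d d'|g d|v|d] /=.
- have [x ->] := qm_surj cP d; have [y ->] := qm_surj cP d'.
  by rewrite -(qm_lin cP) !pE (qm_lin pP).
- by have [x ->] := qm_surj cP d; rewrite -(qm_act cP) !pE (qm_act pP).
- by have [x ->] := qm_surj pP v; exists (c x); rewrite pE.
- have [x ->] := qm_surj cP d; rewrite pE (qm_ker pP).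
  split=> [[y hy]|[d' hd]].
    by exists (c y); rewrite -!(semilinearZ (qm_lin cP)) hy.
  have [y hy] := qm_surj cP d'; move: hd; rewrite hy.
  rewrite -!(semilinearZ (qm_lin cP)) => /cB [z hz]; exists (y + z).
  by rewrite scalerDr -hz addrC subrK.
Qed.

Section ReductionTensor.
Variables (j : nat) (M N : fgmod R G) (V W : fgmod k G) (p : M -> V) (q : N -> W).
Hypotheses (jn : (j < n)%N) (pP : reduction j p) (qP : reduction j q).

(** The comparison map [h] is clearly surjective. For injectivity, order bases of [M] and [N] are
    used: a generator of order at most [j] reduces to zero, and a bilinear form reads off the
    coefficient at a pair of generators of larger order. *)
Lemma reduction_tens : exists r : tens M N -> tens V W, reduction j r.
Proof.
have [T [s sP]] := reduction_exists j (tens M N).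
suff [h [h_inj h_surj]] : exists h : ghom (tens V W) T,
    (forall z, h z = 0 -> z = 0) /\ (forall z, exists x, h x = z).
  by apply: quotient_map_comp sP (fgmod_iso_sym (bij_fgmod_iso h_inj h_surj)).
have sl x x' y : p x = p x' -> s (pure x y) = s (pure x' y).
  move=> /(qm_eq pP) [z hz]; apply/(qm_eq sP); exists (pure z y).
  by rewrite -pureBl -!pureZl hz.
have sr x y y' : q y = q y' -> s (pure x y) = s (pure x y').
  move=> /(qm_eq qP) [z hz]; apply/(qm_eq sP); exists (pure x z).
  by rewrite -pureBr -!pureZr hz.
have /choice [a aE] := qm_surj pP; have /choice [b bE] := qm_surj qP.
pose f v w := s (pure (a v) (b w)).
have fE x y : f (p x) (q y) = s (pure x y).
  by rewrite /f (@sl _ x) -?aE // (@sr _ _ y) -?bE.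
have [pl pr] := @pure_bilinear R M N.
have fb : bilinear_map f.
  split=> c v v' w; have [e <-] := td_surj tdR c.
    have [[x ->] [x' ->]] := (qm_surj pP v, qm_surj pP v').
    have [y ->] := qm_surj qP w.
    by rewrite -(qm_lin pP) !fE pl (qm_lin sP).
  have [[x ->] [x' ->]] := (qm_surj qP v', qm_surj qP w).
  have [y ->] := qm_surj pP v.
  by rewrite -(qm_lin qP) !fE pr (qm_lin sP).
pose h : {linear tens V W -> T} := mklin (tprod_ev_linear fb).
have hE x y : h (pure (p x) (q y)) = s (pure x y).
  by rewrite [LHS](tprod_ev_pure _ _ fb) fE.
have ha g (z : tens V W) : h (act g z) = act g (h z).
  pose id_k := [the {rmorphism k -> k} of idfun].
  have H := @tprod_linear_eq k V W k id_k T (fun z : tens V W => h (act g z))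
    (fun z => act g (h z)).
  apply: H => [c u u'|c u u'|v w].
  - by rewrite !linearP.
  - by rewrite !linearP.
  - have [[x ->] [y ->]] := (qm_surj pP v, qm_surj qP w).
    by rewrite act_pure -(qm_act pP) -(qm_act qP) !hE -(qm_act sP) act_pure.
exists (GHom ha); split=> [z|t]; last first.
  have [z ->] := qm_surj sP t; rewrite (tprod_sum_pure z).
  exists (\sum_(u <- repr z) pure (p u.1) (q u.2)).
  rewrite (semilinear_sum (qm_lin sP)) linear_sum.
  by apply: eq_bigr => u _; exact: hE.
have [m [x [o xo]]] := order_basis_exists tdR (fgmod_fin_gen M).
have [m' [y [o' yo]]] := order_basis_exists tdR (fgmod_fin_gen N).
have [sx x0 xi] := xo; have [sy y0 yi] := yo.
have spx : spans (p \o x).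
  move=> v; have [e ->] := qm_surj pP v; have [c ->] := sx e.
  exists (phi \o c); rewrite (semilinear_sum (qm_lin pP)).
  by apply: eq_bigr => i _; rewrite (semilinearZ (qm_lin pP)).
have sqy : spans (q \o y).
  move=> v; have [e ->] := qm_surj qP v; have [c ->] := sy e.
  exists (phi \o c); rewrite (semilinear_sum (qm_lin qP)).
  by apply: eq_bigr => i _; rewrite (semilinearZ (qm_lin qP)).
have [c ->] := tprod_spans spx sqy z.
have /choice [d hd] := fun i => td_surj tdR (c i).
have -> : \sum_i c i *: pure (p (x i.1)) (q (y i.2)) =
    \sum_i phi (d i) *: pure (p (x i.1)) (q (y i.2)).
  by apply: eq_bigr => i _; rewrite hd.
have -> : GHom ha (\sum_i phi (d i) *: pure (p (x i.1)) (q (y i.2))) =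
    s (\sum_i d i *: pure (x i.1) (y i.2)).
  rewrite (semilinear_sum (qm_lin sP)).
  transitivity (\sum_i h (phi (d i) *: pure (p (x i.1)) (q (y i.2)))).
    exact: (linear_sum h).
  apply: eq_bigr => i _.
  by rewrite linearZ_LR hE (semilinearZ (qm_lin sP)).
move=> /(qm_ker sP) [t ht]; apply: big1 => -[i l] _ /=.
case: (leqP (o i) j) => oi.
  have -> : p (x i) = 0; last by rewrite pure0l scaler0.
  apply/(qm_ker pP)/layer_kill.
  by rewrite -(subnK oi) exprD -scalerA x0 scaler0.
case: (leqP (o' l) j) => ol.
  have -> : q (y l) = 0; last by rewrite pure0r scaler0.
  apply/(qm_ker qP)/layer_kill.
  by rewrite -(subnK ol) exprD -scalerA y0 scaler0.
suff /(td_ker tdR) -> : exists e, d (i, l) = tau * e by rewrite scale0r.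
(* The coordinates at x_i and y_l are defined modulo tau^(j+1), so that their
   product with tau^(n-j-1) is a bilinear form. *)
have [cx [cxE cxl]] := order_basis_coord xo.
have [cy [cyE cyl]] := order_basis_coord yo.
pose eps := tau ^+ (n - j.+1).
have eps0 e : (j < e)%N -> tau ^+ e * eps = 0.
  move=> je; rewrite /eps -exprD -(subnK je) -addnA subnKC // exprD.
  by rewrite (td_nil tdR) mulr0.
have epsM e e' r r' : (j < e)%N -> (exists e'', r - r' = tau ^+ e * e'') ->
    r * (e' * eps) = r' * (e' * eps).
  move=> je [e'' rr']; apply/subr0_eq; rewrite -mulrBl rr'.
  by rewrite -mulrA mulrCA [tau ^+ e * _]mulrCA eps0 // !mulr0.
pose form (u : M) (v : N) : R^o := cx u i * (cy v l * eps).
have formb : bilinear_map form.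
  split=> a1 u u' v; rewrite /form.
    by rewrite (epsM _ _ _ _ oi (cxl a1 u u' i)) mulrDl -mulrA.
  rewrite mulrCA (epsM _ _ _ _ ol (cyl a1 u' v l)) mulrDl -mulrA.
  by rewrite ![cy _ l * (cx u i * eps)]mulrCA.
have [B BE _] := tprod_universal formb; rewrite /form in BE.
have cxx i' : exists e, cx (x i') i - (i' == i)%:R = tau ^+ o i * e.
  apply: (xi (fun i1 => cx (x i') i1 - (i' == i1)%:R)).
  rewrite (eq_bigr (fun i1 => cx (x i') i1 *: x i1 - (i' == i1)%:R *: x i1)).
    rewrite sumrB -cxE (bigD1 i') //= eqxx scale1r big1 ?addr0 ?subrr // => i1.
    by rewrite eq_sym => /negPf ->; rewrite scale0r.
  by move=> i1 _; rewrite scalerBl.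
have cyy l' : exists e, cy (y l') l - (l' == l)%:R = tau ^+ o' l * e.
  apply: (yi (fun l1 => cy (y l') l1 - (l' == l1)%:R)).
  rewrite (eq_bigr (fun l1 => cy (y l') l1 *: y l1 - (l' == l1)%:R *: y l1)).
    rewrite sumrB -cyE (bigD1 l') //= eqxx scale1r big1 ?addr0 ?subrr // => l1.
    by rewrite eq_sym => /negPf ->; rewrite scale0r.
  by move=> l1 _; rewrite scalerBl.
have Bt : B (tau ^+ j.+1 *: t) = 0.
  rewrite (tprod_sum_pure t) scaler_sumr linear_sum big1 // => z' _.
  rewrite linearZ_LR BE -[LHS]/(tau ^+ j.+1 * _) mulrCA [tau ^+ j.+1 * _]mulrCA.
  by rewrite eps0 // !mulr0.
have Bs : B (\sum_k1 d k1 *: pure (x k1.1) (y k1.2)) = d (i, l) * eps.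
  rewrite linear_sum (bigD1 (i, l)) //= big1 => [|[i' l'] ne].
    rewrite addr0 linearZ_LR BE (epsM _ _ _ _ oi (cxx i)) eqxx mul1r.
    have := epsM _ 1 _ _ ol (cyy l).
    by rewrite mul1r eqxx mul1r => ->.
  rewrite linearZ_LR BE /= (epsM _ _ _ _ oi (cxx i')).
  have := epsM _ 1 _ _ ol (cyy l'); rewrite mul1r => ->.
  move: ne; rewrite xpair_eqE negb_and => /orP [] /negPf ->.
    by rewrite mul0r scaler0.
  by rewrite mul0r mulr0 scaler0.
(* This gives [d (i, l) * tau ^+ (n - 1) = 0], and the annihilator of [tau ^+ (n - 1)] is generated
   by [tau]. *)
have := congr1 B ht; rewrite Bt linearZ_LR Bs.
rewrite -[LHS]/(tau ^+ j * (d (i, l) * eps)) mulrCA -exprD.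
have -> : (j + (n - j.+1) = n - 1)%N by rewrite -{2}(subnKC jn) addSn subn1.
rewrite mulrC => /(td_ann tdR (leq_subr 1 n)) [e ->].
by exists e; rewrite subKn ?expr1 //; exact: leq_ltn_trans jn.
Qed.

End ReductionTensor.
End Reduction.

(** * Exact sequences and lifting *)

Section Lifting.
Variables (R k : comPzRingType) (phi : {rmorphism R -> k}) (tau : R) (n : nat).
Hypothesis tdR : truncated_dvr phi tau n.
Variable G : finGroupType.
Implicit Types (L M N D F : fgmod R G) (U V W : fgmod k G).

Local Notation id_R := [the {rmorphism R -> R} of idfun].

(** F_j is additive on R-linear maps, so it may be applied to the splitting of the sequence, which
    is not equivariant. *)
Lemma reduction_exact j L M N U V W (i : ghom L M) (p : ghom M N)
    (a : L -> U) (b : M -> V) (c : N -> W) :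
  R_split_exact i p -> reduction phi tau j a -> reduction phi tau j b ->
  reduction phi tau j c ->
  exists (i' : ghom U V) (p' : ghom V W), R_split_exact i' p'.
Proof.
move=> ex aP bP cP; have [r rK] := exact_retraction ex.
have [_ ker_p p_surj [s sK]] := ex.
have [i' i'E] := reduction_map_hom tdR aP bP i.
have [p' p'E] := reduction_map_hom tdR bP cP p.
have [r' r'E] := reduction_map tdR bP aP r.
exists i', p'; apply: (@exact_of_retraction _ _ _ _ _ _ _ r').
- by move=> u; have [x ->] := qm_surj aP u; rewrite i'E r'E rK.
- move=> v; have [y ->] := qm_surj bP v; rewrite p'E; split=> [pc|[u]].
    have [x hx] : exists x, y - s (p y) = i x.
      by apply/ker_p; rewrite linearB sK subrr.
    exists (a x); rewrite i'E -hx; apply/(qm_eq bP).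
    rewrite opprB addrC subrK.
    by apply: layer_linear; apply/(qm_ker cP).
  have [x ->] := qm_surj aP u; rewrite i'E => yx.
  rewrite -p'E yx p'E (ker_p _).2 ?(semilinear0 (qm_lin cP)) //.
  by exists x.
- move=> w; have [z ->] := qm_surj cP w; have [y ->] := p_surj z.
  by exists (b y); rewrite p'E.
Qed.

(* If F is free over R and pi : F -> V is surjective, then M = F / t^j ker pi
   satisfies t^j M / t^(j+1) M = F / ker pi = V: every kG-module is a layer. *)
Definition lift_ker j (F : fgmod R G) V (pi : F -> V) (x : F) :=
  exists2 y, pi y = 0 & x = tau ^+ j *: y.

(** [cov_tors] is the consequence of freeness that makes F / t^j ker pi have [V] as its layer. *)
Record cover j F V (pi : F -> V) : Prop := Cover {
  cov_lin : semilinear phi pi;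
  cov_act : forall g x, pi (act g x) = act g (pi x);
  cov_surj : forall v, exists x, v = pi x;
  cov_tors : forall x, tau ^+ j *: x = 0 -> pi x = 0 }.

Lemma lift_quotient j F V (pi : F -> V) : cover j pi ->
  exists D (c : F -> D), quotient_map id_R (lift_ker j pi) c.
Proof.
move=> [pl pa ps pt]; apply: quotient_map_exists.
- by move=> c; exists c.
- split=> [|a x y [x' x'0 ->] [y' y'0 ->]].
    by exists 0; rewrite ?scaler0 ?(semilinear0 pl).
  exists (a *: x' + y'); first by rewrite pl x'0 y'0 scaler0 addr0.
  by rewrite scalerDr !scalerA mulrC.
- move=> g x [y y0 ->]; exists (act g y); first by rewrite pa y0 linear0.
  by rewrite linearZ_LR.
- move=> a x /= ->; rewrite scale0r.
  by exists 0; rewrite ?scaler0 ?(semilinear0 pl).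
Qed.

Lemma lift_reduction j F V (pi : F -> V) D (c : F -> D) :
  cover j pi -> quotient_map id_R (lift_ker j pi) c ->
  exists p : D -> V, reduction phi tau j p.
Proof.
move=> [pl pa ps pt] cP.
have kerc x y : c x = c y -> pi x = pi y.
  move=> /(qm_eq cP) [z z0 xy]; apply/subr0_eq; rewrite -(semilinearB pl) xy.
  by rewrite (semilinearZ pl) z0 scaler0.
have /choice [r hr] := qm_surj cP.
have pE x : pi (r (c x)) = pi x by apply: kerc; rewrite -hr.
exists (pi \o r); split=> [a d d'|g d|v|d] /=.
- have [x ->] := qm_surj cP d; have [y ->] := qm_surj cP d'.
  by rewrite -(qm_lin cP) !pE pl.
- by have [x ->] := qm_surj cP d; rewrite -(qm_act cP) !pE pa.
- by have [x ->] := ps v; exists (c x); rewrite pE.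
- have [x ->] := qm_surj cP d; rewrite pE; split=> [x0|[d' hd]].
    apply: layer_kill; rewrite -(semilinearZ (qm_lin cP)).
    by apply/(qm_ker cP); exists x.
  have [y hy] := qm_surj cP d'; move: hd.
  rewrite hy -!(semilinearZ (qm_lin cP)) => /(qm_eq cP) [z z0 hz].
  (* [x - tau *: y - z] is killed by [tau ^+ j]. As [phi tau] and [pi z] are zero, [pi x] is zero as
     well. *)
  have : pi (x - tau *: y - z) = 0.
    by apply: pt; rewrite !scalerBr scalerA -exprSr -hz subrr.
  rewrite !(semilinearB pl) z0 (semilinearZ pl) (phi_tau tdR).
  by rewrite scale0r !subr0.
Qed.

Lemma fin_gen_free m : fin_gen {ffun 'I_m -> R^o}.
Proof.
exists m, (fun i => [ffun l => (i == l)%:R]) => f; exists f; apply/ffunP => l.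
rewrite sum_ffunE (bigD1 l) //= big1 ?addr0 => [|i /negPf il].
  by rewrite !ffunE eqxx /GRing.scale /= mulr1.
by rewrite !ffunE il scaler0.
Qed.

Definition free_mod m : fgmod R G := ffun_mod (triv G (fin_gen_free m)).

Lemma free_mod_lift m (E : lmodType R) (U : lmodType k) (e : E -> U)
    (u : free_mod m -> U) :
  semilinear phi e -> (forall y, exists x, y = e x) -> semilinear phi u ->
  exists r : {linear free_mod m -> E}, forall x, e (r x) = u x.
Proof.
move=> le es lu.
pose dl (z : G * 'I_m) : free_mod m :=
  [ffun h => [ffun i => ((h, i) == z)%:R : R^o]].
have dlE (f : free_mod m) : f = \sum_z (f z.1 z.2 : R) *: dl z.
  apply/ffunP => h; apply/ffunP => i; rewrite sum_ffunE sum_ffunE.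
  rewrite (bigD1 (h, i)) //= big1 ?addr0 => [|z /negPf hz].
    by rewrite !ffunE eqxx /GRing.scale /= mulr1.
  by rewrite !ffunE eq_sym hz scaler0.
have /choice [y hy] := fun z => es (u (dl z)).
have lr : linear (fun f : free_mod m => \sum_z (f z.1 z.2 : R) *: y z).
  move=> a f f'; rewrite scaler_sumr -big_split; apply: eq_bigr => z _.
  by rewrite !ffunE scalerDl scalerA.
exists (mklin lr) => f; rewrite mklinE (semilinear_sum le) [in RHS](dlE f).
rewrite (semilinear_sum lu); apply: eq_bigr => z _.
by rewrite (semilinearZ le) (semilinearZ lu) hy.
Qed.

Section FreeMap.
Variables (m : nat) (V : fgmod k G) (s : 'I_m -> V).

Definition free_map (f : free_mod m) : V :=
  \sum_h \sum_i phi (f h i) *: act h (s i).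

Lemma free_map_linear : semilinear phi free_map.
Proof.
move=> a f f'; rewrite /free_map scaler_sumr -big_split; apply: eq_bigr => h _.
rewrite scaler_sumr -big_split; apply: eq_bigr => i _.
by rewrite !ffunE rmorphD rmorphM scalerDl scalerA.
Qed.

Lemma free_map_act g f : free_map (act g f) = act g (free_map f).
Proof.
rewrite /free_map linear_sum (reindex_inj (mulgI g)); apply: eq_bigr => h _ /=.
rewrite linear_sum; apply: eq_bigr => i _.
by rewrite !ffunE mulKg linearZ_LR actM.
Qed.

(** In a free module, an element killed by [tau ^+ j] is divisible by [tau ^+ (n - j)], and [n - j]
    is positive. *)
Lemma free_map_tors j f : (j < n)%N -> tau ^+ j *: f = 0 -> free_map f = 0.
Proof.
move=> jn f0; apply: big1 => h _; apply: big1 => i _.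
suff -> : phi (f h i) = 0 by rewrite scale0r.
have : tau ^+ j * f h i = 0.
  by have := congr1 (fun f : free_mod m => f h i) f0; rewrite !ffunE.
move=> /(td_ann tdR (ltnW jn)) [b ->].
by rewrite rmorphM rmorphXn (phi_tau tdR) expr0n subn_eq0 leqNgt jn mul0r.
Qed.

Lemma free_map_surj : spans s -> forall v, exists f, v = free_map f.
Proof.
move=> hs v; have [c ->] := hs v.
have /choice [a aE] := fun i => td_surj tdR (c i).
exists [ffun h => [ffun i => if h == 1%g then a i else 0]].
rewrite /free_map (bigD1 1%g) //= [X in _ + X]big1 ?addr0 => [|h /negPf h1].
  by apply: eq_bigr => i _; rewrite !ffunE eqxx aE act1.
by apply: big1 => i _; rewrite !ffunE h1 rmorph0 scale0r.
Qed.

End FreeMap.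

Lemma free_cover_exists j V : (j < n)%N ->
  exists m (s : 'I_m -> V), cover j (free_map s).
Proof.
move=> jn; have [m [s hs]] := fgmod_fin_gen V.
exists m, s; split; [exact: free_map_linear|exact: free_map_act| |].
  exact: free_map_surj.
by move=> x; exact: free_map_tors.
Qed.

Lemma reduction_surj j V : (j < n)%N ->
  exists M (p : M -> V), reduction phi tau j p.
Proof.
move=> /(free_cover_exists V) [m [s cov]].
by have [D [c /(lift_reduction cov) [p pP]]] := lift_quotient cov; exists D, p.
Qed.

(** A horseshoe argument: free covers of [U] and [W] combine into a cover [pV] of [V], and the three
    covers are divided by t^j times their kernels. *)
Lemma exact_lift j U V W (i : ghom U V) (p : ghom V W) :
  (j < n)%N -> R_split_exact i p ->
  exists L M N (i' : ghom L M) (p' : ghom M N)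
         (a : L -> U) (b : M -> V) (c : N -> W),
  [/\ R_split_exact i' p', reduction phi tau j a, reduction phi tau j b &
      reduction phi tau j c].
Proof.
move=> jn [i_inj ker_p p_surj [kap kapK]].
have [m [s covU]] := free_cover_exists U jn.
have [m' [s' covW]] := free_cover_exists W jn.
have /choice [s2 s2E] := fun l => p_surj (s' l).
pose sg := free_map s2.
have sgE y : p (sg y) = free_map s' y.
  rewrite /sg /free_map linear_sum; apply: eq_bigr => h _.
  rewrite linear_sum; apply: eq_bigr => l _.
  by rewrite linearZ_LR ghom_act -s2E.
have sgl : semilinear phi sg := @free_map_linear _ _ _.
set pU := free_map s in covU; set pW := free_map s' in covW sgE.
pose FV := dsum (free_mod m) (free_mod m').
pose pV (z : FV) := i (pU z.1) + sg z.2.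
have piu u : p (i u) = 0 by apply/ker_p; exists u.
have pVW z : p (pV z) = pW z.2 by rewrite /pV linearD piu add0r sgE.
have covV : cover j pV.
  split=> [a z z'|g z|v|z z0].
  - by rewrite /pV /= (cov_lin covU) sgl linearP scalerDr addrACA.
  - by rewrite /pV /= (cov_act covU) ghom_act [sg _]free_map_act linearD.
  - have [y hy] := cov_surj covW (p v).
    have /ker_p [u hu] : p (v - sg y) = 0 by rewrite linearB sgE -hy subrr.
    have [x hx] := cov_surj covU u; exists (x, y).
    by rewrite /pV /= -hx -hu subrK.
  - have [z1 z2] : tau ^+ j *: z.1 = 0 /\ tau ^+ j *: z.2 = 0.
      by case: z z0 => x y [-> ->].
    rewrite /pV (cov_tors covU z1) linear0 add0r.
    exact: free_map_tors jn z2.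
(* [sg] and [kap] after [pW] both lift [pW], so they differ by a map [mu] into [U]. With [r] an
   R-linear lift of [mu], the map [z.1 + r z.2] covers the retraction of [V] onto [U] given by
   [kap]; it therefore sends the kernel of [pV] into that of [pU]. *)
have /choice [mu muE] : forall y, exists u, sg y - kap (pW y) = i u.
  by move=> y; apply/ker_p; rewrite linearB kapK sgE subrr.
have lmu : semilinear phi mu.
  move=> a y y'; apply: i_inj; rewrite linearP -!muE sgl (cov_lin covW).
  by rewrite [kap _]linearP scalerBr opprD addrACA.
have [r rE] := free_mod_lift (cov_lin covU) (cov_surj covU) lmu.
have [L [cU cUP]] := lift_quotient covU.
have [M [cV cVP]] := lift_quotient covV.
have [N [cW cWP]] := lift_quotient covW.
have [a aP] := lift_reduction covU cUP.
have [b bP] := lift_reduction covV cVP.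
have [c cP] := lift_reduction covW cWP.
have idS : forall x, exists y, id_R y = x by move=> x; exists x.
have [i' i'E] : exists i' : ghom L M, forall x, i' (cU x) = cV (x, 0).
  apply: (qm_factor_hom idS cUP (f := fun x => cV (x, 0))) => [e x y|g x|x].
  - rewrite -(qm_lin cVP); congr (cV (_, _)).
    by rewrite /= scaler0 addr0.
  - by rewrite -(qm_act cVP); congr (cV (_, _)); exact: esym (linear0 (act g)).
  - move=> [y y0 ->]; apply/(qm_ker cVP); exists (y, 0).
      by rewrite /pV /= y0 linear0 (semilinear0 sgl) addr0.
    by congr (_, _); rewrite /= scaler0.
have [p' p'E] : exists p' : ghom M N, forall z, p' (cV z) = cW z.2.
  apply: (qm_factor_hom idS cVP (f := fun z => cW z.2)) => [e x y|g x|z].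
  - by rewrite -(qm_lin cWP).
  - by rewrite -(qm_act cWP).
  - move=> [y y0 ->]; apply/(qm_ker cWP); exists y.2 => //.
    by rewrite -pVW y0 linear0.
have [r' r'E] : exists r' : {linear M -> L}, forall z,
    r' (cV z) = cU (z.1 + r z.2).
  apply: (qm_factor idS cVP (f := fun z => cU (z.1 + r z.2))) => [e x y|z].
    by rewrite -(qm_lin cUP) /= linearP scalerDr addrACA.
  move=> [y y0 ->]; apply/(qm_ker cUP); exists (y.1 + r y.2).
    rewrite (semilinearD (cov_lin covU)) rE; apply: i_inj.
    rewrite linearD linear0 -muE addrA -[_ + sg _]/(pV y) y0 sub0r.
    by rewrite -pVW y0 !linear0.
  by rewrite /= linearZ_LR scalerDr.
exists L, M, N, i', p', a, b, c; split=> //.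
apply: (@exact_of_retraction _ _ _ _ _ _ _ r').
- move=> x; have [y ->] := qm_surj cUP x.
  by rewrite i'E r'E /= linear0 addr0.
- move=> y; have [[z1 z2] ->] := qm_surj cVP y; rewrite p'E /=; split.
    move=> /(qm_ker cWP) [y' y'0 ->].
    have /ker_p [u hu] : p (sg y') = 0 by rewrite sgE.
    have [x' hx'] := cov_surj covU u.
    exists (cU (z1 + tau ^+ j *: x')); rewrite i'E; apply/(qm_eq cVP).
    exists (- x', y').
      by rewrite /pV /= (semilinearN (cov_lin covU)) -hx' linearN hu addNr.
    congr (_, _); rewrite /= ?subr0 //.
    by rewrite opprD addrA subrr sub0r scalerN.
  move=> [x]; have [x' ->] := qm_surj cUP x; rewrite i'E => /(congr1 p').
  by rewrite !p'E /= => ->; rewrite (semilinear0 (qm_lin cWP)).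
- move=> z; have [y ->] := qm_surj cWP z; exists (cV (0, y)).
  by rewrite p'E.
Qed.

End Lifting.

(** * Prime ideals *)

Record exact_prime (R : comPzRingType) (G : finGroupType)
    (P : fgmod R G -> Prop) : Prop := ExactPrime {
  ep_thick : exact_thick P;
  ep_ideal : forall X Y, P Y -> P (tens X Y);
  ep_proper : exists X, ~ P X;
  ep_prime : forall X Y, P (tens X Y) -> P X \/ P Y }.

Lemma prime_idealP (R : comPzRingType) (G : finGroupType) (P : fgmod R G -> Prop) :
  @prime_ideal (strel R G) P <-> exact_prime P.
Proof.
split=> [[[/thickP tP id] pr prim]|[tP id pr prim]] //.
by split=> //; split=> //; apply/thickP.
Qed.

(** * Quotients by a scalar as tensor products *)

Section TensorIso.
Variables (R : comPzRingType) (G : finGroupType).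
Implicit Types (L M N : fgmod R G).

Lemma tens_swap M N : exists F : ghom (tens M N) (tens N M),
  forall x y, F (pure x y) = pure y x.
Proof.
have b : @bilinear_map R M N (tens N M) (fun x y => pure y x).
  have [pl pr] := @pure_bilinear R N M.
  by split=> [a x x' y|a x y y']; rewrite (pl, pr).
have [F FE _] := tprod_universal b.
have Fa g (z : tens M N) : F (act g z) = act g (F z : tens N M).
  have H := @tprod_linear_eq R M N R [the {rmorphism R -> R} of idfun]
    (tens N M) (fun z : tens M N => F (act g z))
    (fun z => act g (F z : tens N M)).
  apply: H => [c u v|c u v|x y]; rewrite ?linearP //.
  by rewrite act_pure !FE act_pure.
by exists (GHom Fa).
Qed.

Lemma tens_comm M N : fgmod_iso (tens M N) (tens N M).
Proof.
have [F FE] := tens_swap M N; have [F' F'E] := tens_swap N M.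
pose id_R := [the {rmorphism R -> R} of idfun].
exists F, F'; split.
  apply: (@tprod_linear_eq R M N R id_R (tens M N) (F' \o F) id) => //.
    by move=> a u v; rewrite /= !linearP.
  by move=> x y; rewrite /= FE F'E.
apply: (@tprod_linear_eq R N M R id_R (tens N M) (F \o F') id) => //.
  by move=> a u v; rewrite /= !linearP.
by move=> x y; rewrite /= F'E FE.
Qed.

Lemma homothety_linear (M : fgmod R G) (a : R) : linear (fun x : M => a *: x).
Proof. by move=> b x y; rewrite scalerDr !scalerA mulrC. Qed.

Lemma homothety_act (M : fgmod R G) (a : R) g (x : M) :
  a *: act g x = act g (a *: x).
Proof. by rewrite linearZ_LR. Qed.

Definition homothety a M : ghom M M :=
  mkghom (@homothety_linear M a) (@homothety_act M a).

Definition mod_scalar a M : fgmod R G := coker_mod (homothety a M).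

Definition mod_proj a M : ghom M (mod_scalar a M) := coker_proj (homothety a M).

Definition unit_mod : fgmod R G := triv G (fin_gen1 R).

Lemma coker_projP L M (i : ghom L M) :
  quotient_map [the {rmorphism R -> R} of idfun] (fun x => exists y, x = i y)
    (coker_proj i).
Proof.
split=> [b x y|g x|d|x].
- by rewrite linearP.
- by rewrite ghom_act.
- exact: coker_pi_surj.
- rewrite -[X in _ = X](linear0 (coker_proj i)).
  by split=> [/coker_piP|[y hy]]; [|apply/coker_piP; exists y]; rewrite subr0.
Qed.

Lemma mod_projP a M : quotient_map [the {rmorphism R -> R} of idfun]
  (fun x => exists y, x = a *: y) (mod_proj a M).
Proof. exact: (coker_projP (homothety a M)). Qed.

(** [x] goes to [pure x one], and [f] maps [pure x c] back to the class of [c *: x]. Membership of M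
    / aM in a tensor ideal thus becomes a question about R / aR. *)
Lemma tens_mod_scalar a M :
  fgmod_iso (mod_scalar a M) (tens M (mod_scalar a unit_mod)).
Proof.
pose one : mod_scalar a unit_mod := mod_proj a unit_mod (1 : R).
have oneE (b : R) : mod_proj a unit_mod b = b *: one.
  rewrite -linearZ_LR; congr (mod_proj _ _ _).
  by rewrite /GRing.scale /= mulr1.
have a1 : a *: one = 0.
  rewrite -oneE; apply/(qm_ker (mod_projP a unit_mod)); exists (1 : R).
  by rewrite /GRing.scale /= mulr1.
pose id_R := [the {rmorphism R -> R} of idfun].
have idS : forall x, exists y, id_R y = x by move=> x; exists x.
have [h hE] : exists h : ghom (mod_scalar a M) (tens M (mod_scalar a unit_mod)),
    forall x, h (mod_proj a M x) = pure x one.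
  apply: (qm_factor_hom idS (mod_projP a M)
    (f := fun x => pure x one : tens M (mod_scalar a unit_mod))) => [b x y|g x|x].
  - exact: pure_linear_l.
  - rewrite act_pure; congr (pure _ _).
    by rewrite -ghom_act.
  - by move=> [y ->]; rewrite pureZl -pureZr a1 pure0r.
have /choice [r hr] := qm_surj (mod_projP a unit_mod).
pose b (x : M) q := mod_proj a M ((r q : R) *: x).
have bE x c : b x (mod_proj a unit_mod c) = mod_proj a M ((c : R) *: x).
  apply/(qm_eq (mod_projP a M)).
  have /(qm_eq (mod_projP a unit_mod)) [d hd] := hr (mod_proj a unit_mod c).
  exists (- (d : R) *: x); rewrite -scalerBl -opprB hd.
  by rewrite scalerA mulrN.
have bb : bilinear_map b.
  split=> e x.
    by move=> x' q; rewrite /b scalerDr scalerA mulrC -scalerA linearP.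
  move=> q q'; have [c ->] := qm_surj (mod_projP a unit_mod) q.
  have [c' ->] := qm_surj (mod_projP a unit_mod) q'.
  by rewrite -linearP !bE scalerDl -scalerA linearP.
have [f fE _] := tprod_universal bb.
have fh d : f (h d) = d.
  have [x ->] := qm_surj (mod_projP a M) d.
  by rewrite hE fE bE scale1r.
apply: (@bij_fgmod_iso _ _ _ _ h) => [d hd|z].
  by rewrite -(fh d) hd linear0.
exists (f z); rewrite (tprod_sum_pure z) !linear_sum; apply: eq_bigr => -[x q] _.
have [c ->] /= := qm_surj (mod_projP a unit_mod) q.
by rewrite fE bE hE pureZl -pureZr -oneE.
Qed.

End TensorIso.

Section Primes.
Variables (R k : comPzRingType) (phi : {rmorphism R -> k}) (tau : R) (n : nat).
Hypothesis tdR : truncated_dvr phi tau n.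
Variable G : finGroupType.
Implicit Types (L M N D : fgmod R G) (U V W : fgmod k G).
Implicit Types (P : fgmod R G -> Prop) (Q : fgmod k G -> Prop).

Local Notation id_R := [the {rmorphism R -> R} of idfun].
Local Notation modp i M := (mod_scalar (tau ^+ i) M).
Local Notation unit_modp i := (modp i (unit_mod R G)).
Local Notation reduction := (reduction phi tau).

Definition pullback j Q M := exists V (p : M -> V), reduction j p /\ Q V.

Definition restriction j P V := exists M (p : M -> V), reduction j p /\ P M.

Definition has_index j P := P (unit_modp j) /\ ~ P (unit_modp j.+1).

Lemma pullbackE j Q M V (p : M -> V) : exact_thick Q -> reduction j p ->
  pullback j Q M <-> Q V.
Proof.
move=> tQ pP; split=> [[W [q [qP QW]]]|QV]; last by exists V, p.
exact: (et_iso tQ (reduction_unique tdR pP qP)).2.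
Qed.

(** Applying F_j to the R-linear map [u] turns its trace into a trace. *)
Lemma reduction_stable_retract j M N V W (p : M -> V) (q : N -> W) :
  reduction j p -> reduction j q -> stable_retract M N -> stable_retract V W.
Proof.
move=> pP qP [f [h [u hu]]].
have [f' f'E] := reduction_map_hom tdR pP qP f.
have [h' h'E] := reduction_map_hom tdR qP pP h.
have [u' u'E] := reduction_map tdR pP pP u.
exists f', h', u' => v; have [x ->] := qm_surj pP v.
rewrite [in LHS](hu x) (semilinearD (qm_lin pP)) f'E h'E; congr (_ + _).
rewrite /trace (semilinear_sum (qm_lin pP)); apply: eq_bigr => g _.
by rewrite (qm_act pP) -u'E (qm_act pP).
Qed.

Lemma reduction0 j : reduction j (fun _ : zero_mod R G => 0 : zero_mod k G).
Proof.
split=> [a x y|g x|d|x]; first by rewrite scaler0 addr0.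
- by rewrite linear0.
- by exists 0; apply/rowP => -[].
- by split=> // _; exists 0; apply/rowP => -[].
Qed.

(** Each clause is transported by F_j; properness holds because every kG-module is a layer. *)
Lemma pullback_prime j Q : (j < n)%N -> exact_prime Q ->
  exact_prime (pullback j Q).
Proof.
move=> jn [tQ idQ [V nV] prQ]; split.
- split.
  + by apply/(pullbackE tQ (reduction0 j)); exact: et_zero.
  + move=> M N MN; have [W [q qP]] := reduction_exists tdR j N.
    have [U [p pP]] := reduction_exists tdR j M.
    move=> /(pullbackE tQ qP) QW; apply/(pullbackE tQ pP).
    exact: (et_retract tQ (reduction_stable_retract pP qP MN)).
  + move=> L M N i p ex; have [U [a aP]] := reduction_exists tdR j L.
    have [W [b bP]] := reduction_exists tdR j M.
    have [T [c cP]] := reduction_exists tdR j N.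
    have [i' [p' ex']] := reduction_exact tdR ex aP bP cP.
    have [H1 H2 H3] := et_exact tQ ex'.
    have [a1 a2] := pullbackE tQ aP; have [b1 b2] := pullbackE tQ bP.
    have [c1 c2] := pullbackE tQ cP.
    by split=> [/a1 HX /b1 HY|/a1 HX /c1 HZ|/b1 HY /c1 HZ]; auto.
- move=> X Y; have [U [a aP]] := reduction_exists tdR j X.
  have [W [b bP]] := reduction_exists tdR j Y.
  have [r rP] := reduction_tens tdR jn aP bP.
  by move=> /(pullbackE tQ bP) QW; apply/(pullbackE tQ rP); exact: idQ.
- have [M [p pP]] := reduction_surj tdR V jn.
  by exists M => /(pullbackE tQ pP).
- move=> X Y; have [U [a aP]] := reduction_exists tdR j X.
  have [W [b bP]] := reduction_exists tdR j Y.
  have [r rP] := reduction_tens tdR jn aP bP.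
  move=> /(pullbackE tQ rP)/prQ [?|?]; [left|right].
    exact/(pullbackE tQ aP).
  exact/(pullbackE tQ bP).
Qed.

(** * The index of a prime *)

Section Index.
Variables (P : fgmod R G -> Prop) (primeP : exact_prime P).
Let tP := ep_thick primeP.

Lemma mod_proj_iso i M : (forall x : M, tau ^+ i *: x = 0) ->
  fgmod_iso M (modp i M).
Proof.
move=> M0; apply: (@bij_fgmod_iso _ _ _ _ (mod_proj (tau ^+ i) M)) => [x|y].
  by move=> /(qm_ker (mod_projP _ _)) [y ->]; exact: M0.
by have [x ->] := qm_surj (mod_projP _ _) y; exists x.
Qed.

(** Such an [M] equals M / tau^i M, the tensor product of [M] with [unit_modp i]. *)
Lemma ep_killed i M : P (unit_modp i) -> (forall x : M, tau ^+ i *: x = 0) -> P M.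
Proof.
move=> Pi /mod_proj_iso iso; apply/(et_iso tP iso).
by apply/(et_iso tP (tens_mod_scalar _ _)); exact: (ep_ideal primeP).
Qed.

Lemma ep_mod_scalar i M : ~ P (unit_modp i) -> P M <-> P (modp i M).
Proof.
move=> nPi; have iso := et_iso tP (tens_mod_scalar (tau ^+ i) M).
split=> [PM|/iso.1/(ep_prime primeP) [] //].
by apply/iso.2/(et_iso tP (tens_comm _ _)); exact: (ep_ideal primeP).
Qed.

(** [unit_modp 0] is zero, while [unit_modp n] generates everything as a tensor ideal; membership is
    lost at some step in between. *)
Lemma has_index_exists : exists2 j, (j < n)%N & has_index j P.
Proof.
have P0 : P (unit_modp 0).
  apply: (et_null tP) => x; have [y ->] := qm_surj (mod_projP _ _) x.
  by apply/(qm_ker (mod_projP _ _)); exists y; rewrite expr0 scale1r.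
have nPn : ~ P (unit_modp n).
  move=> Pn; have [X] := ep_proper primeP; apply; apply: (ep_killed Pn) => x.
  by rewrite (td_nil tdR) scale0r.
case: (pselect (forall i, (i < n)%N -> P (unit_modp i) -> P (unit_modp i.+1))).
  move=> step; case: nPn.
  suff : forall i, (i <= n)%N -> P (unit_modp i) by apply.
  by elim=> // i IH lt; apply: step => //; apply: IH; exact: ltnW.
move=> nstep; apply: contrapT => nex; apply: nstep => i lt Pi.
by apply: contrapT => nPi; apply: nex; exists i.
Qed.

Lemma has_index_unit i j : has_index j P -> P (unit_modp i) <-> (i <= j)%N.
Proof.
have killed a b : (a <= b)%N -> P (unit_modp b) -> P (unit_modp a).
  move=> ab Pb; apply: (ep_killed Pb) => x.
  have [y ->] := qm_surj (mod_projP _ _) x.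
  rewrite -linearZ_LR; apply/(qm_ker (mod_projP _ _)).
  by exists (tau ^+ (b - a) *: y); rewrite scalerA -exprD subnKC.
move=> [Pj nPj]; split=> [Pi|ij]; last exact: killed Pj.
by rewrite leqNgt; apply/negP => /killed /(_ Pi).
Qed.

Lemma has_index_unique i j : has_index i P -> has_index j P -> i = j.
Proof.
move=> hi hj; apply/eqP; rewrite eqn_leq.
by apply/andP; split; [apply/(has_index_unit i hj)|apply/(has_index_unit j hi)];
  [case: hi|case: hj].
Qed.

End Index.

(* When tau^(j+1) kills [M] and [N], the quotient is the pushout of [M] and [N]
   along t^j M = V = t^j N. *)
Definition pushout_ker j M N V (p : M -> V) (q : N -> V) (z : dsum M N) :=
  exists x y, [/\ p x = q y, z.1 = tau ^+ j *: x & z.2 = - (tau ^+ j *: y)].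

(** An R-linear lift [f] from [N] to [M] of the identity of [V] gives the retraction [z.1 + f z.2].
    It kills [pushout_ker] because [tau ^+ j *: x] depends only on [p x] when [tau ^+ j.+1] kills
    [M]. *)
Lemma pushout_exact j M N V D (p : M -> V) (q : N -> V) (c : dsum M N -> D) :
  reduction j p -> reduction j q -> (forall x : M, tau ^+ j.+1 *: x = 0) ->
  quotient_map id_R (pushout_ker j p q) c ->
  exists (i : ghom M D) (r : ghom D (modp j N)), R_split_exact i r.
Proof.
move=> pP qP M0 cP; have idS : forall x, exists y, id_R y = x by move=> x; exists x.
have pker x : p x = 0 -> tau ^+ j *: x = 0.
  by move=> /(qm_ker pP) [y ->]; rewrite M0.
have [f fE] := reduction_lift tdR qP pP [the {linear V -> V} of idfun] M0.
have [i iE] : exists i : ghom M D, forall x, i x = c (x, 0).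
  have li : linear (fun x => c (x, 0)).
    move=> a x y; rewrite -(qm_lin cP); congr (c (_, _)).
    by rewrite /= scaler0 addr0.
  have ai g x : c (act g x, 0) = act g (c (x, 0)).
    rewrite -(qm_act cP); congr (c (_, _)); exact: esym (linear0 (act g)).
  by exists (mkghom li ai).
have [r rE] : exists r : ghom D (modp j N),
    forall z, r (c z) = mod_proj (tau ^+ j) N z.2.
  apply: (qm_factor_hom idS cP (f := fun z => mod_proj (tau ^+ j) N z.2)).
  - by move=> a x y; rewrite -[RHS]linearP.
  - by move=> g x; rewrite -[RHS]ghom_act.
  - move=> z [x [y [_ _ ->]]]; apply/(qm_ker (mod_projP _ _)).
    by exists (- y); rewrite scalerN.
have [s sE] : exists s : {linear D -> M}, forall z, s (c z) = z.1 + f z.2.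
  apply: (qm_factor idS cP (f := fun z => z.1 + f z.2)) => [a x y|z].
    by rewrite /= linearP scalerDr addrACA.
  move=> [x [y [xy -> ->]]].
  rewrite linearN linearZ_LR -scalerBr; apply: pker.
  by rewrite (semilinearB (qm_lin pP)) fE xy subrr.
exists i, r; apply: (@exact_of_retraction _ _ _ _ _ _ _ s).
- by move=> x; rewrite iE sE /= linear0 addr0.
- move=> d; have [[x y] ->] := qm_surj cP d; rewrite rE /=.
  split=> [/(qm_ker (mod_projP _ _)) [y' ->]|[x']].
    have [x' hx'] := qm_surj pP (q (- y')).
    exists (x - tau ^+ j *: x'); rewrite iE; apply/(qm_eq cP).
    exists x', (- y'); split; rewrite //= ?scalerN ?opprK ?subr0 //.
    by rewrite opprB addrC subrK.
  by rewrite iE => /(congr1 r); rewrite !rE /= => ->; rewrite linear0.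
- move=> d; have [y ->] := qm_surj (mod_projP _ _) d.
  by exists (c (0, y)); rewrite rE.
Qed.

(** * The image of a prime of index j under the layer functor *)

Section Restriction.
Variables (P : fgmod R G -> Prop) (j : nat).
Hypotheses (primeP : exact_prime P) (jn : (j < n)%N) (jP : has_index j P).
Let tP := ep_thick primeP.

Lemma reduction_mod_proj M V (p : M -> V) : reduction j p ->
  exists p' : modp j.+1 M -> V, reduction j p'.
Proof.
move=> pP.
have [//|p' p'P _] := reduction_quot pP (mod_projP (tau ^+ j.+1) M).
by exists p'.
Qed.

Lemma mod_proj_killed i M (x : modp i M) : tau ^+ i *: x = 0.
Proof.
have [y ->] := qm_surj (mod_projP _ _) x; rewrite -linearZ_LR.
by apply/(qm_ker (mod_projP _ _)); exists y.
Qed.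

Lemma reduction_determines M N V (p : M -> V) (q : N -> V) :
  reduction j p -> reduction j q -> P M <-> P N.
Proof.
have [Pj nPj] := jP.
wlog [M0 N0] : M N p q / (forall x : M, tau ^+ j.+1 *: x = 0) /\
    (forall x : N, tau ^+ j.+1 *: x = 0) => [H|pP qP].
  move=> /reduction_mod_proj [p' p'P] /reduction_mod_proj [q' q'P].
  have iM := ep_mod_scalar primeP M nPj; have iN := ep_mod_scalar primeP N nPj.
  rewrite iM iN; apply: H p'P q'P.
  by split=> x; exact: mod_proj_killed.
have [D [c cP]] : exists D (c : dsum M N -> D),
    quotient_map id_R (pushout_ker j p q) c.
  apply: quotient_map_exists.
  - by move=> x; exists x.
  - split=> [|a z z' [x [y [xy zx zy]]] [x' [y' [xy' zx' zy']]]].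
      exists 0, 0; rewrite (semilinear0 (qm_lin pP)) (semilinear0 (qm_lin qP)).
      by rewrite !scaler0 oppr0.
    exists (a *: x + x'), (a *: y + y').
    rewrite (qm_lin pP) (qm_lin qP) xy xy' /= zx zx' zy zy'; split=> //.
      by rewrite scalerDr !scalerA mulrC.
    by rewrite scalerDr !scalerA [_ * a]mulrC scalerN scalerA opprD.
  - move=> g z [x [y [xy zx zy]]]; exists (act g x), (act g y).
    rewrite (qm_act pP) (qm_act qP) xy /= zx zy; split=> //.
      by rewrite linearZ_LR.
    by rewrite linearN linearZ_LR.
  - move=> a z /= ->; rewrite scale0r.
    exists 0, 0; rewrite (semilinear0 (qm_lin pP)) (semilinear0 (qm_lin qP)).
    by rewrite !scaler0 oppr0.
(* The pushout is symmetric in [M] and [N] up to sign, so [pushout_exact] applies from both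
   sides. *)
pose swap (z : dsum N M) : dsum M N := (z.2, z.1).
have cP' : quotient_map id_R (pushout_ker j q p) (c \o swap).
  split=> [a x y|g x|d|z] /=.
  - by rewrite -(qm_lin cP).
  - by rewrite -(qm_act cP).
  - by have [[x y] ->] := qm_surj cP d; exists (y, x).
  - rewrite (qm_ker cP); split=> -[x [y [xy z1 z2]]].
      exists (- y), (- x); rewrite (semilinearN (qm_lin pP)).
      rewrite (semilinearN (qm_lin qP)) xy; split=> //.
        by rewrite scalerN.
      by rewrite scalerN opprK.
    exists (- y), (- x); rewrite (semilinearN (qm_lin pP)).
    rewrite (semilinearN (qm_lin qP)) xy; split=> //=.
      by rewrite scalerN.
    by rewrite scalerN opprK.
(* [D] is an extension of [modp j L] by [K], and [modp j L] belongs to [P], being killed by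
   [tau ^+ j]. *)
have PD (K L : fgmod R G) (E : fgmod k G) (p0 : K -> E) (q0 : L -> E)
    (c0 : dsum K L -> D) :
    reduction j p0 -> reduction j q0 -> (forall x : K, tau ^+ j.+1 *: x = 0) ->
    quotient_map id_R (pushout_ker j p0 q0) c0 -> P K <-> P D.
  move=> p0P q0P K0 c0P; have [i [r ex]] := pushout_exact p0P q0P K0 c0P.
  have [_ H2 H3] := et_exact tP ex.
  have PN : P (modp j L) by apply: (ep_killed primeP Pj); exact: mod_proj_killed.
  by split=> H; auto.
by rewrite (PD _ _ _ _ _ _ pP qP M0 cP) (PD _ _ _ _ _ _ qP pP N0 cP').
Qed.

Lemma restrictionE M V (p : M -> V) : reduction j p -> restriction j P V <-> P M.
Proof.
move=> pP; split=> [[N [q [qP PN]]]|PM]; last by exists M, p.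
by apply/(reduction_determines pP qP).
Qed.

(** Equivariant maps between layers are not lifted; only the R-linear [u] is, to [v]. The trace of
    [v] factors through [ffun_mod M], so [V] is a summand of W + F_j(ffun_mod M). Lifting the
    complement [C] to [K], the modules M + K and N + ffun_mod M have isomorphic layers, and
    [reduction_determines] applies. *)
Lemma restriction_retract V W :
  stable_retract V W -> restriction j P W -> restriction j P V.
Proof.
move=> [f [h [u hu]]] [N [q [qP PN]]].
have [M0 [p0 /reduction_mod_proj [p pP]]] := reduction_surj tdR V jn.
(* Dividing by [tau ^+ j.+1] keeps the layer and makes [reduction_lift] applicable. *)
set M := modp j.+1 M0 in p pP.
have [v vE] := reduction_lift tdR pP pP u (@mod_proj_killed _ _).
have [T [s sP]] := reduction_exists tdR j (ffun_mod M).
have [a aE] := reduction_map_hom tdR pP sP (const_hom M).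
have [b bE] := reduction_map_hom tdR sP pP (trace_hom v).
have iK : cancel (pair_hom f a) (copair_hom h b).
  move=> x; rewrite [RHS]hu; congr (_ + _); rewrite /=.
  have [y ->] := qm_surj pP x; rewrite aE bE trace_factor /trace.
  rewrite (semilinear_sum (qm_lin pP)); apply: eq_bigr => g _.
  by rewrite (qm_act pP) vE (qm_act pP).
have [C iso] := retract_summand iK.
have [K [c cP]] := reduction_surj tdR C jn.
have [r rP] := quotient_map_comp (reduction_dsum pP cP) iso.
have : P (dsum M K).
  apply/(reduction_determines rP (reduction_dsum qP sP)).
  by apply/(et_dsum _ _ tP); split=> //; exact: et_ffun_mod.
by move=> /(et_dsum _ _ tP) [PM _]; apply/(restrictionE pP).
Qed.

Lemma restriction_prime : exact_prime (restriction j P).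
Proof.
have thick : exact_thick (restriction j P).
  split; last 1 first.
  - move=> U V W i p ex.
    have [L [M [N [i' [p' [a [b [c [ex' aP bP cP]]]]]]]]] := exact_lift tdR jn ex.
    have [H1 H2 H3] := et_exact tP ex'.
    have [a1 a2] := restrictionE aP; have [b1 b2] := restrictionE bP.
    have [c1 c2] := restrictionE cP.
    by split=> [/a1 HX /b1 HY|/a1 HX /c1 HZ|/b1 HY /c1 HZ]; auto.
  - by apply/(restrictionE (reduction0 j)); exact: et_zero.
  - exact: restriction_retract.
split=> //.
- move=> V W; have [M [p pP]] := reduction_surj tdR V jn.
  have [N [q qP]] := reduction_surj tdR W jn.
  have [r rP] := reduction_tens tdR jn pP qP.
  move=> /(restrictionE qP) PN; apply/(restrictionE rP).
  exact: (ep_ideal primeP).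
- have [M nM] := ep_proper primeP; have [V [p pP]] := reduction_exists tdR j M.
  by exists V => /(restrictionE pP).
- move=> V W; have [M [p pP]] := reduction_surj tdR V jn.
  have [N [q qP]] := reduction_surj tdR W jn.
  have [r rP] := reduction_tens tdR jn pP qP.
  move=> /(restrictionE rP)/(ep_prime primeP) [?|?]; [left|right].
    exact/(restrictionE pP).
  exact/(restrictionE qP).
Qed.

Lemma pullback_restriction M : pullback j (restriction j P) M <-> P M.
Proof.
have [V [p pP]] := reduction_exists tdR j M.
by rewrite (pullbackE (ep_thick restriction_prime) pP) (restrictionE pP).
Qed.

End Restriction.

(** * The index and the restriction of a pulled back prime *)

Section Pullback.
Variables (Q : fgmod k G -> Prop) (j : nat).
Hypotheses (primeQ : exact_prime Q) (jn : (j < n)%N).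
Let tQ := ep_thick primeQ.

Lemma restriction_pullback V : restriction j (pullback j Q) V <-> Q V.
Proof.
split=> [[M [p [pP /(pullbackE tQ pP)]]] //|QV].
have [M [p pP]] := reduction_surj tdR V jn.
by exists M, p; split=> //; apply/(pullbackE tQ pP).
Qed.

(** The layer F_j of [unit_modp j] is zero. If [unit_modp j.+1] were in the pullback, so would be
    every module killed by [tau ^+ j.+1]; every kG-module is a layer of such a module, against the
    properness of [Q]. *)
Lemma pullback_has_index : has_index j (pullback j Q).
Proof.
have pr := pullback_prime jn primeQ; split.
  have [V [p pP]] := reduction_exists tdR j (unit_modp j).
  apply/(pullbackE tQ pP)/(et_null tQ) => v.
  have [x ->] := qm_surj pP v; apply/(qm_ker pP)/layer_kill.
  exact: mod_proj_killed.
move=> Hj; have [V []] := ep_proper primeQ.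
have [M [p pP]] := reduction_surj tdR V jn.
have [p' p'P] := reduction_mod_proj pP.
apply/(pullbackE tQ p'P); apply: (ep_killed pr Hj); exact: mod_proj_killed.
Qed.

End Pullback.
End Primes.

(** * The homeomorphism *)

Lemma spc_eq (K : ttcat) (p q : spc_pt K) :
  (forall X, sval p X <-> sval q X) -> p = q.
Proof.
case: p q => [P pP] [Q qQ] /= PQ; apply: eq_exist.
by apply/funext => X; apply/propext.
Qed.

Section Homeomorphism.
Variables (R k : comPzRingType) (phi : {rmorphism R -> k}) (tau : R) (n : nat).
Hypothesis tdR : truncated_dvr phi tau n.
Variable G : finGroupType.

Local Notation modp i M := (mod_scalar (tau ^+ i) M).
Local Notation unit_modp i := (modp i (unit_mod R G)).
Local Notation reduction := (reduction phi tau).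

(* A cone of the projection from the unit to [unit_modp i]: it belongs to the
   primes of index less than [i] only. *)
Definition separator i : fgmod R G :=
  coker_mod (ghom_comp (const_hom (unit_mod R G))
    (homothety (tau ^+ i) (unit_mod R G))).

(** The separator is the pushout of [const_hom] and the projection onto [unit_modp i]. Evaluation at
    1 retracts [const_hom], hence splits the sequence over [R]. *)
Lemma separator_exact i :
  exists (f : ghom (unit_mod R G) (dsum (ffun_mod (unit_mod R G)) (unit_modp i)))
    (p : ghom (dsum (ffun_mod (unit_mod R G)) (unit_modp i)) (separator i)),
    R_split_exact f p.
Proof.
set u := unit_mod R G; pose c := ghom_comp (const_hom u) (homothety (tau ^+ i) u).
have mP := mod_projP (tau ^+ i) u; have cP := coker_projP c.
have idS : forall x, exists y, [the {rmorphism R -> R} of idfun] y = x.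
  by move=> x; exists x.
have [h hE] : exists h : ghom (unit_modp i) (separator i),
    forall x, h (mod_proj (tau ^+ i) u x) = coker_proj c (const_hom u x).
  apply: (qm_factor_hom idS mP (f := fun x => coker_proj c (const_hom u x))).
  - by move=> a x y; rewrite !linearP.
  - exact: (ghom_act (ghom_comp (coker_proj c) (const_hom u))).
  - by move=> x [y ->]; apply/(qm_ker cP); exists y.
pose f := pair_hom (const_hom u)
  (ghom_comp (homothety (-1) (unit_modp i)) (mod_proj (tau ^+ i) u)).
have fE x : f x = (const_hom u x, - mod_proj (tau ^+ i) u x).
  by congr (_, _); exact: scaleN1r.
pose p := copair_hom (coker_proj c) h.
have pE z m : p (z, m) = coker_proj c z + h m by [].
have lr : linear (fun z : dsum (ffun_mod u) (unit_modp i) => z.1 1%g : u).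
  by move=> a z z'; rewrite !ffunE.
exists f, p; apply: (@exact_of_retraction _ _ _ _ _ _ _ (mklin lr)).
- by move=> x; rewrite mklinE /= ffunE.
- move=> [z m]; have [x ->] := qm_surj mP m.
  have -> : p (z, mod_proj (tau ^+ i) u x) = coker_proj c (z + const_hom u x).
    by rewrite pE linearD -hE.
  rewrite (qm_ker cP); split=> [[y hy]|[y]].
    exists (tau ^+ i *: y - x); rewrite fE; congr (_, _).
      by rewrite linearB -[const_hom u (_ *: y)]/(c y) -hy addrK.
    rewrite -linearN; apply/(qm_eq mP); exists y.
    by rewrite opprK addrC subrK.
  rewrite fE -linearN => -[-> /(qm_eq mP) [w hw]].
  exists w; rewrite -[RHS]/(const_hom u (tau ^+ i *: w)) -hw opprK.
  by rewrite [RHS]linearD addrC.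
- move=> z; have [x ->] := qm_surj cP z; exists (x, 0).
  by rewrite pE linear0 addr0.
Qed.

(** For [i <= j], two out of three would put the unit in [P]. For [j < i], the separator divides an
    [ffun_mod] by a submodule of its multiples of [tau ^+ j.+1], so both have the same layer F_j. *)
Lemma has_index_separator P i j : exact_prime P ->
  has_index tau j P -> P (separator i) <-> (j < i)%N.
Proof.
move=> primeP jP; have tP := ep_thick primeP; split=> [Ps|ji].
  rewrite ltnNge; apply/negP => ij.
  have [f [p ex]] := separator_exact i; have [_ _ H] := et_exact tP ex.
  have Pu : P (unit_mod R G).
    apply: H => //; apply/(et_dsum _ _ tP); split; first exact: et_ffun_mod.
    exact/(has_index_unit primeP _ jP).
  by have [_ nPj] := jP; exact/nPj/(ep_mod_scalar primeP _ nPj).1.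
have [V [p pP]] := reduction_exists tdR j (ffun_mod (unit_mod R G)).
set c := ghom_comp (const_hom (unit_mod R G)) (homothety (tau ^+ i) (unit_mod R G)).
have [|p' p'P _] := reduction_quot pP (coker_projP c).
  move=> x [y ->]; exists (tau ^+ (i - j.+1) *: const_hom (unit_mod R G) y).
  by rewrite scalerA -exprD subnKC // -linearZ_LR.
by apply/(reduction_determines tdR primeP jP p'P pP); exact: et_ffun_mod.
Qed.

Local Notation X := (Spc (strel R G)).
Local Notation Y := (coprod (fun _ : 'I_n => Spc (strel k G))).

Definition spc_pullback (y : Y) : X :=
  let: existT i q := y in
  exist _ (pullback phi tau i (sval q)) ((prime_idealP _).2
    (pullback_prime tdR (ltn_ord i) ((prime_idealP _).1 (svalP q)))).

Lemma ord_index (x : X) : exists i : 'I_n, has_index tau i (sval x).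
Proof.
have [j jn jP] := has_index_exists tdR ((prime_idealP _).1 (svalP x)).
by exists (Ordinal jn).
Qed.

Definition spc_index (x : X) : 'I_n := sval (cid (ord_index x)).

Lemma spc_indexP (x : X) : has_index tau (spc_index x) (sval x).
Proof. exact: (svalP (cid (ord_index x))). Qed.

Definition spc_restriction (x : X) : Y :=
  existT _ (spc_index x) (exist _ (restriction phi tau (spc_index x) (sval x))
    ((prime_idealP _).2 (restriction_prime tdR ((prime_idealP _).1 (svalP x))
      (ltn_ord (spc_index x)) (spc_indexP x)))).

Lemma spc_restrictionK : cancel spc_restriction spc_pullback.
Proof.
move=> x; apply: spc_eq => M /=.
apply: (pullback_restriction tdR _ (ltn_ord _) (spc_indexP x)).
exact: (prime_idealP _).1 (svalP x).
Qed.

Lemma spc_pullbackK : cancel spc_pullback spc_restriction.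
Proof.
move=> [i q]; have primeQ := (prime_idealP _).1 (svalP q).
have ii : spc_index (spc_pullback (existT _ i q)) = i.
  apply/ord_inj/(has_index_unique (pullback_prime tdR (ltn_ord i) primeQ)).
    exact: spc_indexP.
  exact: (pullback_has_index tdR primeQ (ltn_ord i)).
(* The proof of [has_index] is generalised first because its type depends on the index being
   rewritten. *)
rewrite /spc_restriction; move: (spc_indexP _).
rewrite ii => h; congr (existT _ _ _); apply: spc_eq => V /=.
exact: (restriction_pullback tdR primeQ (ltn_ord i) V).
Qed.

(** On the i-th copy, the preimage of [supp M] is the support of F_i(M). *)
Lemma spc_pullback_continuous : continuous_map spc_pullback.
Proof.
move=> U [A hA] i.
exists (fun V : fgmod k G =>
  exists (M : fgmod R G) (p : M -> V), reduction i p /\ A M) => q.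
have tQ := ep_thick ((prime_idealP _).1 (svalP q)).
rewrite (hA (spc_pullback (existT _ i q))); split=> H.
  move=> V [M [p [pP AM]]] QV; apply: (H M AM).
  exact/(pullbackE tdR tQ pP).
move=> M AM [V [p [pP QV]]]; apply: (H V) QV.
by exists M, p.
Qed.

(** The family consists of all [M] whose support contains the closed complement of the preimage. For
    each [x] in the preimage, such an [M] belonging to [x] has to be found. *)
Lemma spc_restriction_continuous : continuous_map spc_restriction.
Proof.
move=> V oV.
exists (fun M => forall x, ~ V (spc_restriction x) -> supp M x) => x.
split=> [nV M|H]; first exact.
move=> Vx; set i := spc_index x.
have [A hA] := oV i.
have primex := (prime_idealP _).1 (svalP x).
have [W AW QW] : exists2 W, A W & restriction phi tau i (sval x) W.
  apply: contrapT => nW; apply: (hA _).2 Vx => W AW QW.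
  by apply: nW; exists W.
have [M [p [pP PM]]] := QW.
(* A prime contains the last two summands exactly when its index is at least [i] and less than
   [i.+1]; within index [i], [T] is detected by [M]. *)
pose T := dsum M (dsum (unit_modp i) (separator i.+1)).
have [Pi _] := spc_indexP x.
have /H : forall y, ~ V (spc_restriction y) -> supp (T : strel R G) y; last first.
  apply; do 2?[apply/(et_dsum _ _ (ep_thick primex)); split=> //].
  exact/(has_index_separator _ primex (spc_indexP x)).
move=> y nVy PT; have primey := (prime_idealP _).1 (svalP y).
have [PyM /(et_dsum _ _ (ep_thick primey)) [Py1 Py2]] :=
  (et_dsum _ _ (ep_thick primey)).1 PT.
have iy := spc_indexP y.
have ii : spc_index y = i.
  apply/ord_inj/eqP; rewrite eqn_leq.
  have := (has_index_separator _ primey iy).1 Py2.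
  by rewrite ltnS => ->; apply/(has_index_unit primey _ iy).
move: nVy; rewrite /spc_restriction; move: (spc_indexP y); rewrite ii => iy'.
move/(hA _).1/(_ W AW); apply => /=.
by exists M, p.
Qed.

Lemma spc_strel_homeomorphic : homeomorphic X Y.
Proof.
exists spc_restriction; split; first exact: spc_restriction_continuous.
exists spc_pullback; split; first exact: spc_restrictionK.
  exact: spc_pullbackK.
exact: spc_pullback_continuous.
Qed.

End Homeomorphism.

(** * Quotients of a discrete valuation ring *)

Section QuotientProjection.
Local Open Scope quotient_scope.
Variables (S : comPzRingType) (a b e : S).
Hypothesis bE : b = a * e.

Local Notation A := (principal_quot a).
Local Notation B := (principal_quot b).

Definition pquot_proj (c : B) : A := \pi_A (repr c).

Lemma pquot_proj_pi x : pquot_proj (\pi_B x) = \pi_A x.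
Proof.
apply/eqP/pquotP.
have /pquotP [z ->] : \pi_B (repr (\pi_B x)) == \pi_B x by rewrite reprK.
by exists (e * z); rewrite bE mulrA.
Qed.

Lemma pquot_pi0 (f : S) : (0 : principal_quot f) = \pi_(principal_quot f) 0.
Proof.
by apply: (addrI (\pi_(principal_quot f) 0)); rewrite pquot_piD !addr0.
Qed.

Lemma pquot_proj_nmod : nmod_morphism pquot_proj.
Proof.
split=> [|c d]; first by rewrite pquot_pi0 pquot_proj_pi -pquot_pi0.
rewrite -[c]reprK -[d]reprK [X in pquot_proj X]pquot_piD !pquot_proj_pi.
by symmetry; exact: (pquot_piD a).
Qed.

Lemma pquot_proj_monoid : monoid_morphism pquot_proj.
Proof.
split; first exact: pquot_proj_pi.
move=> c d; rewrite -[c]reprK -[d]reprK.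
rewrite [X in pquot_proj X](pquot_piM b) !pquot_proj_pi.
by symmetry; exact: (pquot_piM a).
Qed.

Definition pquot_rmorph : {rmorphism B -> A} :=
  HB.pack_for {rmorphism B -> A} pquot_proj
    (GRing.isNmodMorphism.Build B A pquot_proj pquot_proj_nmod)
    (GRing.isMonoidMorphism.Build B A pquot_proj pquot_proj_monoid).

End QuotientProjection.

Section DiscreteValuationRing.
Local Open Scope quotient_scope.
Variables (S : idomainType) (t : S).
Hypotheses (dvrS : dvr S) (tP : uniformiser t).

(** The ideal generated by [t] and [x] is strictly larger than the maximal ideal generated by [t],
    so it contains 1. *)
Lemma uniformiser_bezout x : x \notin principal t ->
  exists c d, 1 = t * c + x * d.
Proof.
move=> nx; have [_ n1 tmax] := tP.
pose J y := exists c d, y = t * c + x * d.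
apply: contrapT => nJ; move/negP: nx; apply; apply: (tmax J).
- split=> [|f _ _ [c [d ->]] [c' [d' ->]]].
    by exists 0, 0; rewrite !mulr0 addr0.
  exists (f * c + c'), (f * d + d').
  by rewrite !mulrDr addrACA ![_ * (f * _)]mulrCA.
- exact: nJ.
- by move=> y /principalP [z ->]; exists z, 0; rewrite mulr0 addr0.
- by exists 0, 1; rewrite mulr0 add0r mulr1.
Qed.

(** If [t] were zero, the Bezout relation would make every nonzero element invertible, and [S] is
    not a field. *)
Lemma uniformiser_neq0 : t != 0.
Proof.
have [_ _ [x xn0 xnu]] := dvrS; apply/eqP => t0; move/negP: xnu; apply.
have [|c [d]] := @uniformiser_bezout x.
  by apply/principalP => -[z hz]; move: xn0; rewrite hz t0 mul0r eqxx.
by rewrite t0 mul0r add0r => xd; apply/unitrPr; exists d.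
Qed.

Lemma uniformiser_val m (x : S) : (exists y, x = t ^+ m * y) \/
  exists b y, [/\ (b < m)%N, x = t ^+ b * y & y \notin principal t].
Proof.
elim: m => [|m [[y ->]|[b [y [bm -> ny]]]]].
- by left; exists x; rewrite expr0 mul1r.
- case: (boolP (y \in principal t)) => [/principalP [z ->]|ny].
    by left; exists z; rewrite mulrA -exprSr.
  by right; exists m, y.
- by right; exists b, y; split=> //; exact: ltnW.
Qed.

Variable n : nat.
Hypothesis n_gt0 : (0 < n)%N.

Local Notation R := (principal_quot (t ^+ n)).
Local Notation k := (principal_quot t).

Lemma expr_uniformiser : t ^+ n = t * t ^+ n.-1.
Proof. by rewrite -exprS prednK. Qed.

Lemma dvr_truncated :
  truncated_dvr (pquot_rmorph expr_uniformiser) (\pi_R t : R) n.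
Proof.
have piM x y : (\pi_R x : R) * \pi_R y = \pi_R (x * y) by exact: pquot_piM.
have piX x m : (\pi_R x : R) ^+ m = \pi_R (x ^+ m).
  by elim: m => // m IH; rewrite exprS IH piM -exprS.
have piE x y : (\pi_R x : R) = \pi_R y <-> exists z, x - y = t ^+ n * z.
  by split=> [/eqP/pquotP|/pquotP/eqP].
have projE x : pquot_rmorph expr_uniformiser (\pi_R x) = \pi_k x.
  exact: (pquot_proj_pi expr_uniformiser).
split.
- by move=> c; exists (\pi_R (repr c)); rewrite projE reprK.
- move=> a; rewrite -[a]reprK; split=> [|[b]].
    rewrite projE pquot_pi0 => /eqP /pquotP [z]; rewrite subr0 => ->.
    by exists (\pi_R z); rewrite piM.
  rewrite -[b]reprK piM => ->; rewrite projE pquot_pi0.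
  by apply/eqP/pquotP; exists (repr b); rewrite subr0.
- by rewrite piX pquot_pi0; apply/piE; exists 1; rewrite subr0 mulr1.
- move=> a; rewrite -[a]reprK.
  have [[y ->]|[b [y [bn -> /uniformiser_bezout [c [d cd]]]]]] :=
    uniformiser_val n (repr a).
    (* A multiple of [t ^+ n] is zero in [R], which is written as 1 times the n-th power. *)
    exists n, 1, 1; rewrite mulr1 mul1r piX; split=> //.
    apply/piE; exists (y - 1); by rewrite mulrBr mulr1.
  (* [y * d = 1 - t * c] is invertible modulo [t ^+ n], where [t] is nilpotent. *)
  exists b, (\pi_R y), (\pi_R (d * \sum_(i < n) (t * c) ^+ i)).
  rewrite piX !piM [t ^+ b * y]mulrC; split=> //.
  apply/piE; exists (- c ^+ n).
  have -> : y * (d * \sum_(i < n) (t * c) ^+ i) = 1 - (t * c) ^+ n.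
    rewrite mulrA -[y * d](addKr (t * c)) -cd addrC.
    by rewrite -[in RHS](expr1n _ n) subrXX; congr (_ * _); apply: eq_bigr => i _;
       rewrite expr1n mul1r.
  by rewrite addrC addKr exprMn mulrN.
- move=> m a mn; rewrite -[a]reprK piX piM pquot_pi0 => /piE [z].
  rewrite subr0 => az; exists (\pi_R z); rewrite piX piM.
  have -> // : repr a = t ^+ (n - m) * z.
  apply: (mulfI (expf_neq0 m uniformiser_neq0)).
  by rewrite az mulrA -exprD subnKC.
Qed.

End DiscreteValuationRing.

Theorem theorem1p1 (S : idomainType) (t : S) (G : finGroupType) (n : nat)
    (hS : dvr S) (ht : uniformiser t) (hn : (0 < n)%N) :
  homeomorphic (Spc (strel (principal_quot (t ^+ n)) G))
    (coprod (fun _ : 'I_n => Spc (strel (principal_quot t) G))).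
Proof.
exact: (spc_strel_homeomorphic (dvr_truncated hS ht hn)). Qed.
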